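(* Let $n\ge1$ and let $(x_1,u_1),(x,u)\in\mathbb{R}^n\times\mathbb{R}$. If $x_1=-x$ and $2|u-u_1|\ge\pi|x|^2$, then $$d_{CC}\left((x_1,u_1),(x,u)\right)=\sqrt{2\pi|u-u_1|}.$$ Otherwise, the equation $$\frac{2(u-u_1)}{|x_1|^2+|x|^2}=\frac{b}{\sin^2b}-\cot b+\frac{2x_1\cdot x}{|x_1|^2+|x|^2}\cdot\frac{1-b\cot b}{\sin b}$$ has a unique solution $b$ in the interval $(-\pi,\pi)$, and with this $b$ $$d_{CC}\left((x_1,u_1),(x,u)\right)=\frac{b}{\sin b}\sqrt{|x_1|^2+|x|^2-2x_1\cdot x\cos b}=\sqrt{2b(u-u_1)+(|x_1|^2+|x|^2)\,b\cot b-2x_1\cdot x\,\frac{b}{\sin b}}.$$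
   Context: On $\mathbb{R}^{n+1}=\mathbb{R}^n_x\times\mathbb{R}_u$ consider the vector fields $X_j=\partial_{x_j}$, $U_j=x_j\partial_u$ ($j=1,\dots,n$). For $p\in\mathbb{R}^{n+1}$ and a tangent vector $v$ at $p$ put $\|v\|_p^2=\inf\{\sum_{j=1}^n(\alpha_j^2+\beta_j^2): v=\sum_{j=1}^n(\alpha_jX_j(p)+\beta_jU_j(p))\}$, with $\inf\varnothing=\infty$. A horizontal curve is an absolutely continuous curve $\gamma:[0,1]\to\mathbb{R}^{n+1}$ with $\dot\gamma(t)\in\mathrm{span}\{X_j(\gamma(t)),U_j(\gamma(t)):1\le j\le n\}$ for almost every $t$; its length is $L(\gamma)=\int_0^1\|\dot\gamma(t)\|_{\gamma(t)}\,dt$. The Carnot–Carathéodory distance $d_{CC}(p,q)$ is the infimum of $L(\gamma)$ over all horizontal curves $\gamma$ with $\gamma(0)=p$, $\gamma(1)=q$. Expressions in $b$ with a removable singularity at $b=0$ are extended there by continuity: $\frac{b}{\sin b}$ and $b\cot b$ take the value $1$, while $\frac{b}{\sin^2b}-\cot b$ and $\frac{1-b\cot b}{\sin b}$ take the value $0$. *)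

(* Defs.v *)
From HB Require Import structures.
From mathcomp Require Import all_boot all_order all_algebra.
From mathcomp Require Import all_classical all_reals all_analysis.
Set Implicit Arguments.
Unset Strict Implicit.
Unset Printing Implicit Defensive.
Import Order.TTheory GRing.Theory Num.Theory.
Import numFieldNormedType.Exports.
Local Open Scope classical_set_scope.
Local Open Scope ring_scope.

(* The library norm `|x| on 'rV[R]_n is the sup norm; the Euclidean norm of   *)
(* the source enters only through the dot product below.                      *)
Definition dotv (R : realType) (n : nat) (x y : 'rV[R]_n) : R :=
  \sum_(j < n) x 0 j * y 0 j.

Definition sqnorm (R : realType) (n : nat) (x : 'rV[R]_n) : R := dotv x x.

Section CarnotCaratheodory.
Context {R : realType} {n : nat}.

(* A point is a pair (x, u); tangent vectors at any point live in the same    *)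
(* vector space.                                                              *)
Local Notation E := ('rV[R]_n * R)%type.

Definition X_field (j : 'I_n) (p : E) : E := (delta_mx 0 j, 0).
Definition U_field (j : 'I_n) (p : E) : E := (0, p.1 0 j).

Definition hcomb (p : E) (alpha beta : 'I_n -> R) : E :=
  \sum_(j < n) (alpha j *: X_field j p + beta j *: U_field j p).

Definition hspan (p : E) : set E :=
  [set v | exists alpha beta : 'I_n -> R, v = hcomb p alpha beta].

Definition cc_sqnorm (p v : E) : \bar R :=
  ereal_inf [set r | exists alpha beta : 'I_n -> R,
    v = hcomb p alpha beta /\
    r = (\sum_(j < n) (alpha j ^+ 2 + beta j ^+ 2))%:E].

Definition cc_norm (p v : E) : \bar R := sqrte (cc_sqnorm p v).

(* The choice of norm on V is irrelevant in finite dimension. *)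
Definition abs_continuous (V : normedModType R) (a b : R) (f : R -> V) : Prop :=
  forall e : R, 0 < e -> exists2 d : R, 0 < d &
    forall (N : nat) (l r : 'I_N -> R),
      (forall i, a <= l i /\ l i <= r i /\ r i <= b) ->
      trivIset [set: 'I_N] (fun i => `]l i, r i[%classic) ->
      \sum_(i < N) (r i - l i) < d ->
      \sum_(i < N) `|f (r i) - f (l i)| < e.

(* Curves on [0,1] are represented by functions on R, of which only the       *)
(* values on [0,1] matter (the derivative at the endpoints is negligible).    *)
Definition horizontal (g : R -> E) : Prop :=
  abs_continuous 0 1 g /\
  {ae (@lebesgue_measure R), forall t, t \in `[0%R, 1%R] ->
     derivable g t 1 /\ hspan (g t) (derive1 g t)}.

Definition cc_length (g : R -> E) : \bar R :=
  \int[@lebesgue_measure R]_(t in `[0%R, 1%R]) cc_norm (g t) (derive1 g t).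

Definition d_CC (p q : E) : \bar R :=
  ereal_inf [set cc_length g | g in
    [set g | horizontal g /\ g 0 = p /\ g 1 = q]].

End CarnotCaratheodory.

Definition cot (R : realType) (b : R) : R := cos b / sin b.

(* Continuous extensions at b = 0 of b / sin b, b cot b,                      *)
(* b / sin^2 b - cot b and (1 - b cot b) / sin b, respectively.               *)
Definition b_over_sin (R : realType) (b : R) : R :=
  if b == 0 then 1 else b / sin b.

Definition b_cot (R : realType) (b : R) : R :=
  if b == 0 then 1 else b * cot b.

Definition mu_fun (R : realType) (b : R) : R :=
  if b == 0 then 0 else b / sin b ^+ 2 - cot b.

Definition nu_fun (R : realType) (b : R) : R :=
  if b == 0 then 0 else (1 - b * cot b) / sin b.

(* Main.v *)
Require Import Defs.
From HB Require Import structures.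
From mathcomp Require Import all_boot all_order all_algebra.
From mathcomp Require Import all_classical all_reals all_analysis.
From mathcomp Require Import measurable_realfun ring lra.
Set Implicit Arguments.
Unset Strict Implicit.
Unset Printing Implicit Defensive.
Import Order.TTheory GRing.Theory Num.Theory.
Import numFieldNormedType.Exports.
Local Open Scope classical_set_scope.
Local Open Scope ring_scope.

(** Lower bound: for [|b| < pi] the function
      [W s (x, u) = 2 b u - b^2 T |x|^2 + 2 al <v, x> - T |v|^2],
    with [T = tan (b (s - 1/2)) / b] and [al = 1 / cos (b (s - 1/2))], solves the
    Hamilton-Jacobi equation [W_s + |grad_H W|^2 / 4 = 0].  Hence, along a
    horizontal curve [g] of length less than [L], reparametrized by an absolutely
    continuous time [s] with [L s' >= ||g'||], the function [W (s, g) - L^2 s] has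
    nonpositive derivative almost everywhere, so that
    [W 1 (g 1) - W 0 (g 0) <= L^2].  For the best [v] the left-hand side is
      [2 b (u - u1) + (|x1|^2 + |x|^2) b cot b - 2 <x1, x> b / sin b],
    whose critical points in [b] are the solutions of the equation of the theorem.

    Upper bound: the curves [x(t) = cos (b t) x1 + sin (b t) z], [u' = b |x|^2] have
    constant speed [|b| sqrt (|x1|^2 + |z|^2)].  If [x1 <> - x] or [|u - u1|] is
    small, one of them with [|b| < pi] attains the lower bound; otherwise one takes
    [b = pi] or [b = - pi], where the endpoint [- x1] does not depend on [z].

    Equation: with [t = b / 2] and [c = 2 <x1, x> / (|x1|^2 + |x|^2)] in [[-1, 1]]
    its right-hand side is the convex combination
      [(1 + c) / 2 (t / cos^2 t + tan t) + (1 - c) / 2 (t / sin^2 t - cot t)]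
    of two increasing functions on [(- pi / 2, pi / 2)], the first one unbounded,
    the second one with range [(- pi / 2, pi / 2)]. *)

(** * Absolutely continuous functions *)

(** Real induction: the supremum of the points of [[a, b]] satisfying [P] is reached by a step from
    a nearby smaller point, and unless it is [b], another step passes it. Steps straddle [t] because
    increments across [t] are what the derivative at [t] controls. *)
Lemma interval_chain (R : realType) (P : R -> Prop) (a b : R) :
  a <= b -> P a ->
  (forall t, a <= t <= b -> exists2 d : R, 0 < d &
     forall s1 s2, a <= s1 -> s1 <= t -> t <= s2 -> s2 <= b ->
       t - d < s1 -> s2 < t + d -> P s1 -> P s2) ->
  P b.
Proof.
move=> ab Pa step.
pose A := [set t : R | [/\ a <= t, t <= b & P t]].
have Aa : A a by split.
have supA : has_sup A by split; [exists a|exists b => t []].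
have as_ : a <= sup A by apply: (ub_le_sup supA.2).
have sb : sup A <= b by apply: sup_le_ub; [exists a|move=> t []].
have [|d d0 Pd] := step (sup A); first by rewrite as_.
have [s1 [as1 s1b Ps1] s1sup] := sup_adherent d0 supA.
have s1s : s1 <= sup A by apply: (ub_le_sup supA.2); split.
have Ps : P (sup A) by apply: (Pd s1) => //; rewrite ltrDl.
have := sb; rewrite le_eqVlt => /predU1P[<-//|sltb].
pose s2 := Num.min b (sup A + d / 2).
have ss2 : sup A < s2 by rewrite lt_min sltb ltrDl divr_gt0.
have s2b : s2 <= b by rewrite ge_min lexx.
have As2 : A s2.
  split => //; first by rewrite (le_trans as_)// ltW.
  apply: (Pd s1) => //; first exact: ltW.
  by rewrite gt_min; apply/orP; right; rewrite ltrD2l; lra.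
by have := ub_le_sup supA.2 As2; rewrite leNgt ss2.
Qed.

Lemma lebesgue_measure_itvoo_le (R : realType) (l r : R) : l <= r ->
  lebesgue_measure `]l, r[%classic = (r - l)%:E.
Proof.
move=> lr; rewrite lebesgue_measure_itv/= lte_fin; case: ltP => // rl.
by have /eqP -> : r == l; [rewrite eq_le rl lr|rewrite subrr].
Qed.

Lemma sum_itv_le_measure (R : realType) (U : set R) N (l r : 'I_N -> R) :
  measurable U -> (forall i, l i <= r i) ->
  (forall i, `]l i, r i[%classic `<=` U) ->
  trivIset [set: 'I_N] (fun i => `]l i, r i[%classic) ->
  ((\sum_(i < N) (r i - l i))%:E <= (@lebesgue_measure R) U)%E.
Proof.
move=> mU lr lrU tlr.
have -> : ((\sum_(i < N) (r i - l i))%:E =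
    \sum_(i < N) (@lebesgue_measure R) `]l i, r i[%classic)%E.
  by rewrite -sumEFin; apply: eq_bigr => i _; rewrite lebesgue_measure_itvoo_le.
rewrite -(@measure_bigsetU_ord _ _ _ _ _ xpredT)//.
apply: le_measure; rewrite ?inE//.
  by apply: bigsetU_measurable => i _; exact: measurable_itv.
by elim/big_ind: _ => // A B AU BU x [/AU|/BU].
Qed.

(** Splitting the increment at [t] leaves two one-sided difference quotients based at [t]. This is
    the step of the real induction at points outside the null set. *)
Lemma derivable1_le_slope (R : realType) (h : R -> R) (t e : R) :
  derivable h t 1 -> derive1 h t <= 0 -> 0 < e ->
  exists2 d : R, 0 < d & forall s1 s2, s1 <= t -> t <= s2 ->
     t - d < s1 -> s2 < t + d -> h s2 - h s1 <= e * (s2 - s1).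
Proof.
move=> dh h't e0.
have /cvgrPdist_lt/(_ _ e0)[d/= d0 H] :
    (fun s : R => s^-1 *: (h (s *: (1 : R) + t) - h t)) @ 0^' --> derive1 h t.
  by rewrite derive1E.
have K s : s != 0 -> `|s| < d -> s^-1 * (h (s + t) - h t) < e.
  move=> s0 sd; have := H s; rewrite /ball_/= sub0r normrN => /(_ sd s0).
  rewrite [s *: (1 : R)]mulr1 ltr_distlC => /andP[_]/lt_le_trans; apply.
  by rewrite gerDr.
have Kr s : t <= s -> s < t + d -> h s - h t <= e * (s - t).
  rewrite le_eqVlt => /predU1P[<-|ts] sd; first by rewrite !subrr mulr0.
  have st0 : 0 < s - t by rewrite subr_gt0.
  have := K (s - t); rewrite gt_eqF// gtr0_norm// ltrBlDl => /(_ isT sd).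
  by rewrite subrK ltr_pdivrMl// mulrC => /ltW.
have Kl s : s <= t -> t - d < s -> h t - h s <= e * (t - s).
  rewrite le_eqVlt => /predU1P[<-|ts] sd; first by rewrite !subrr mulr0.
  have st0 : s - t < 0 by rewrite subr_lt0.
  have := K (s - t); rewrite lt_eqF// ltr0_norm// opprB ltrBlDl -ltrBlDr => /(_ isT sd).
  by rewrite subrK ltr_ndivrMl// => /ltW; lra.
exists d => // s1 s2 s1t ts2 s1d s2d.
have := Kr _ ts2 s2d; have := Kl _ s1t s1d; lra.
Qed.

(* Real induction on [t]: outside a null set [h] grows at rate at most [e1]; around
   a point of the null set the oscillation of [h] is charged to an interval inside
   an open set of measure less than [d], where absolute continuity controls the
   total oscillation. *)
Lemma ac_le0_derive (R : realType) (h : R -> R) (a b : R) : a <= b ->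
  abs_continuous a b h ->
  {ae (@lebesgue_measure R), forall t, t \in `[a, b] ->
     derivable h t 1 /\ derive1 h t <= 0} ->
  h b <= h a.
Proof.
move=> ab ach [N [mN N0 hN]]; rewrite -subr_le0; apply/ler_addgt0Pr => e e0.
rewrite add0r.
have ba1 : 0 < b - a + 1 by rewrite ltr_wpDl// subr_ge0.
(* Chosen so that [e1 * (b - a) <= e / 2]; the [+ 1] covers [a = b]. *)
pose e1 := e / 2 / (b - a + 1).
have e10 : 0 < e1 by rewrite !divr_gt0.
have [|d d0 hd] := ach (e / 2); first by rewrite divr_gt0.
have [|U [oU NU muUN]] := @lebesgue_regularity_outer R N d mN _ d0.
  by move: N0 => /= ->.
have mU := open_measurable oU.
(* Outer regularity bounds the measure of [U] minus [N]; the rest of [U] lies in the null set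
   [N]. *)
have muU : ((@lebesgue_measure R) U < d%:E)%E.
  have -> : (lebesgue_measure U =
      lebesgue_measure (U `\` N) + lebesgue_measure (U `&` N))%E.
    exact: measureDI.
  suff -> : (lebesgue_measure (U `&` N) = 0)%E by rewrite adde0.
  apply/eqP; rewrite -measure_le0 -N0 le_measure ?inE//.
  exact: measurableI.
(* The intervals come in increasing order and end by [t], so that a step can append one on the right
   and disjointness follows from the order. *)
pose P t := exists (M : nat) (l r : nat -> R),
  [/\ forall i, (i < M)%N -> [/\ a <= l i, l i <= r i, r i <= t &
        `]l i, r i[%classic `<=` U],
      forall i j, (i < j < M)%N -> r i <= l j &
      h t - h a <= e1 * (t - a) + \sum_(i < M) `|h (r i) - h (l i)|].
suff [M [l [r [lr lrM hM]]]] : P b.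
  have ltr : trivIset [set: 'I_M] (fun i => `]l i, r i[%classic).
    apply/trivIsetP => i j _ _; wlog ij : i j / (i < j)%N => [hw|] ineqj.
      move: (ineqj); rewrite neq_ltn => /orP[ij|ji]; first exact: hw.
      by rewrite setIC; apply: hw => //; rewrite eq_sym.
    rewrite -subset0 => x [/=]; rewrite !in_itv/= => /andP[_ xr] /andP[lx _].
    have : r i <= l j by apply: lrM; rewrite ij/=.
    by move: xr lx; lra.
  have := hd M (fun i => l i) (fun i => r i).
  have lrd : \sum_(i < M) (r i - l i) < d.
    rewrite -lte_fin; apply: le_lt_trans muU; apply: sum_itv_le_measure => //.
    - by move=> i; have [] := lr i (ltn_ord i).
    - by move=> i; have [] := lr i (ltn_ord i).
  move=> /(_ _ ltr lrd) H.
  have {}H : \sum_(i < M) `|h (r i) - h (l i)| < e / 2.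
    by apply: H => i; have [? ? ? _] := lr i (ltn_ord i).
  rewrite (le_trans hM)//.
  have : e1 * (b - a) <= e / 2.
    rewrite /e1 mulrAC ler_pdivrMr// ler_pM2l ?divr_gt0//; lra.
  by move: H; lra.
apply: (interval_chain ab).
  by exists 0, (fun=> 0), (fun=> 0); split => //; rewrite big_ord0 !subrr mulr0 addr0.
move=> t tab; have [Nt|Nt] := pselect (N t).
  have /nbhs_ballP[c/= c0 cU] : nbhs t U by apply: open_nbhs_nbhs; split => //; apply: NU.
  exists c => // s1 s2 as1 s1t ts2 s2b cs1 s2c [M [l [r [lr lrM hM]]]].
  exists M.+1, (fun i => if i == M then s1 else l i),
    (fun i => if i == M then s2 else r i); split.
  - move=> i; rewrite ltnS leq_eqVlt; case: eqP => /= [_ _|_ iM].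
      split => //; first lra.
      move=> x /=; rewrite in_itv/= => /andP[s1x xs2]; apply: cU.
      rewrite /ball/= ltr_distlC; apply/andP; split; lra.
    have [? ? ? ?] := lr i iM; split => //; lra.
  - move=> i j /andP[ij]; rewrite ltnS leq_eqVlt.
    case: eqP => /= [jM _|_ jM]; last first.
      by rewrite ltn_eqF ?(ltn_trans ij)//; apply: lrM; rewrite ij.
    have iM : (i < M)%N by rewrite -jM.
    by rewrite ltn_eqF//; have [] := lr i iM.
  rewrite big_ord_recr/= eqxx.
  under eq_bigr => i _ do rewrite ltn_eqF//.
  have := ler_norm (h s2 - h s1).
  have : e1 * (s1 - a) <= e1 * (s2 - a) by rewrite ler_pM2l//; lra.
  by move: hM; lra.
have [dht h't] : derivable h t 1 /\ derive1 h t <= 0.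
  by apply: contrapT => H; apply/Nt/hN => /=; apply: contra_not H; apply; rewrite in_itv.
have [c c0 hc] := derivable1_le_slope dht h't e10.
exists c => // s1 s2 as1 s1t ts2 s2b cs1 s2c [M [l [r [lr lrM hM]]]].
exists M, l, r; split => //.
  by move=> i /lr[? ? ? ?]; split => //; lra.
have := hc _ _ s1t ts2 cs1 s2c; move: hM; lra.
Qed.

Section AbsContinuous.
Context {R : realType}.
Implicit Types (V W : normedModType R) (a b : R).

Lemma ac_le V W a b (f : R -> V) (g : R -> W) :
  (forall s t, a <= s -> s <= t -> t <= b -> `|g t - g s| <= `|f t - f s|) ->
  abs_continuous a b f -> abs_continuous a b g.
Proof.
move=> gf acf e e0; have [d d0 H] := acf e e0; exists d => // N l r lr tlr lrd.
apply: le_lt_trans (H N l r lr tlr lrd); apply: ler_sum => i _.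
by have [? [? ?]] := lr i; apply: gf.
Qed.

Lemma ac_lipschitz V a b (f : R -> V) (k : R) : 0 <= k ->
  (forall s t, a <= s -> s <= t -> t <= b -> `|f t - f s| <= k * (t - s)) ->
  abs_continuous a b f.
Proof.
move=> k0 fk e e0; exists (e / (k + 1)); first by rewrite divr_gt0// ltr_wpDl.
move=> N l r lr _; rewrite ltr_pdivlMr ?ltr_wpDl// => H; apply: le_lt_trans H.
rewrite mulr_suml; apply: ler_sum => i _; have [? [? ?]] := lr i.
rewrite (le_trans (fk _ _ _ _ _))// mulrC ler_wpM2l ?subr_ge0//; lra.
Qed.

Lemma ac_cst a b (c : R) : abs_continuous a b (fun=> c).
Proof.
by apply: (@ac_lipschitz _ _ _ _ 0) => // s t _ _ _; rewrite subrr normr0 mul0r.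
Qed.

(** Common source of the closure under sums, scalar multiples, products and pairs: each term of the
    increment bound receives half of [e]. *)
Lemma ac_comb V W (X : normedModType R) a b (f : R -> V) (g : R -> W) (h : R -> X)
    (k1 k2 : R) :
  0 <= k1 -> 0 <= k2 ->
  abs_continuous a b f -> abs_continuous a b g ->
  (forall s t, a <= s -> s <= t -> t <= b ->
    `|h t - h s| <= k1 * `|f t - f s| + k2 * `|g t - g s|) ->
  abs_continuous a b h.
Proof.
move=> k10 k20 acf acg hfg e e0.
have k1p : 0 < k1 + 1 by rewrite ltr_wpDl.
have k2p : 0 < k2 + 1 by rewrite ltr_wpDl.
have [|d1 d10 H1] := acf (e / 2 / (k1 + 1)); first by rewrite !divr_gt0.
have [|d2 d20 H2] := acg (e / 2 / (k2 + 1)); first by rewrite !divr_gt0.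
exists (Num.min d1 d2); first by rewrite lt_min d10.
move=> N l r lr tlr; rewrite lt_min => /andP[lr1 lr2].
have := H1 N l r lr tlr lr1; rewrite ltr_pdivlMr// => {}H1.
have := H2 N l r lr tlr lr2; rewrite ltr_pdivlMr// => {}H2.
rewrite (splitr e); apply: le_lt_trans (ltrD H1 H2).
rewrite !mulr_suml -big_split/=; apply: ler_sum => i _; have [? [? ?]] := lr i.
rewrite (le_trans (hfg _ _ _ _ _))// lerD// mulrC ler_wpM2l//; lra.
Qed.

Lemma acD a b (f g : R -> R) :
  abs_continuous a b f -> abs_continuous a b g ->
  abs_continuous a b (fun t => f t + g t).
Proof.
move=> acf acg; apply: (ac_comb ler01 ler01 acf acg) => s t _ _ _.
by rewrite opprD addrACA !mul1r ler_normD.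
Qed.

Lemma acZ a b (k : R) (f : R -> R) :
  abs_continuous a b f -> abs_continuous a b (fun t => k * f t).
Proof.
move=> acf; apply: (ac_comb (normr_ge0 k) (lexx 0) acf acf) => s t _ _ _.
by rewrite -mulrBr normrM mul0r addr0.
Qed.

Lemma acB a b (f g : R -> R) :
  abs_continuous a b f -> abs_continuous a b g ->
  abs_continuous a b (fun t => f t - g t).
Proof.
move=> acf /(acZ (-1)) acg.
rewrite (_ : (fun t => _) = fun t => f t + (-1) * g t); first exact: acD.
by apply/funext => t; rewrite mulN1r.
Qed.

Lemma ac_sum a b n (f : 'I_n -> R -> R) :
  (forall i, abs_continuous a b (f i)) ->
  abs_continuous a b (fun t => \sum_(i < n) f i t).
Proof.
elim: n f => [|n IH] f acf.
  rewrite (_ : (fun t => _) = fun=> 0); first exact: ac_cst.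
  by apply/funext => t; rewrite big_ord0.
rewrite (_ : (fun t => _) =
    fun t => \sum_(i < n) f (widen_ord (leqnSn n) i) t + f ord_max t); last first.
  by apply/funext => t; rewrite big_ord_recr.
by apply: acD => //; apply: (IH (fun i => f (widen_ord (leqnSn n) i))) => i; exact: acf.
Qed.

(** A family of one interval in the definition already gives uniform continuity. *)
Lemma ac_continuous V a b (f : R -> V) : abs_continuous a b f ->
  forall e, 0 < e -> exists2 d, 0 < d & forall s t, a <= s <= b -> a <= t <= b ->
    `|t - s| < d -> `|f t - f s| < e.
Proof.
move=> acf e e0; have [d d0 H] := acf e e0; exists d => // s t.
wlog st : s t / s <= t => [hw|] sab tab tsd.
  have [|ts] := leP s t; first by move=> st; exact: hw.
  by rewrite distrC; apply: hw => //; [exact: ltW|rewrite distrC].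
have := H 1%N (fun=> s) (fun=> t); rewrite !big_ord1; apply.
- by move=> _; lra.
- by apply/trivIsetP => i j _ _; rewrite !ord1.
- by move: tsd; rewrite ger0_norm// subr_ge0.
Qed.

(** Real induction: by uniform continuity, a step shorter than [d] raises the bound by at most
    [1]. *)
Lemma ac_bounded V a b (f : R -> V) : a <= b -> abs_continuous a b f ->
  exists2 M, 0 <= M & forall t, a <= t <= b -> `|f t| <= M.
Proof.
move=> ab acf; have [d d0 H] := ac_continuous acf ltr01.
pose P (s : R) := exists2 M, 0 <= M & forall t, a <= t <= s -> `|f t| <= M.
apply: (@interval_chain R P a b ab).
  by exists `|f a| => // t ta; have -> : t = a by lra.
move=> t tab; exists (d / 2); first by rewrite divr_gt0.
move=> s1 s2 as1 s1t ts2 s2b ds1 s2d [M M0 HM]; exists (M + 1); first by rewrite addr_ge0.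
move=> s /andP[as_ ss2]; have [ss1|s1s] := leP s s1.
  by rewrite (le_trans (HM _ _)) ?as_// lerDl.
have := H s1 s; rewrite (_ : `|s - s1| < d); last by rewrite ger0_norm; lra.
have : `|f s| <= `|f s1| + `|f s - f s1|.
  by rewrite (le_trans _ (ler_normD _ _))// addrC subrK.
have := HM s1; rewrite as1 lexx => /(_ isT).
move=> h1 h2 h3; have : `|f s - f s1| < 1 by apply: h3; lra.
lra.
Qed.

Lemma acM a b (f g : R -> R) : a <= b ->
  abs_continuous a b f -> abs_continuous a b g ->
  abs_continuous a b (fun t => f t * g t).
Proof.
move=> ab acf acg.
have [M M0 fM] := ac_bounded ab acf.
have [K K0 gK] := ac_bounded ab acg.
apply: (ac_comb K0 M0 acf acg) => s t as_ st tb.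
have -> : f t * g t - f s * g s = g t * (f t - f s) + f s * (g t - g s) by ring.
rewrite (le_trans (ler_normD _ _))// !normrM lerD// ler_wpM2r//.
  by apply: gK; lra.
by apply: fM; lra.
Qed.

Lemma ac_comp_lipschitz a b (f s : R -> R) (k c d : R) : 0 <= k ->
  (forall t, a <= t <= b -> c <= s t <= d) ->
  (forall x y, c <= x <= d -> c <= y <= d -> `|f y - f x| <= k * `|y - x|) ->
  abs_continuous a b s -> abs_continuous a b (f \o s).
Proof.
move=> k0 scd fk acs; apply: (ac_comb k0 (lexx 0) acs acs) => x y ax xy yb.
by rewrite mul0r addr0/= fk// scd//; lra.
Qed.

End AbsContinuous.

(** * The horizontal norm *)

Section DotProduct.
Context {R : realType} {n : nat}.
Implicit Types (x y z : 'rV[R]_n) (k : R).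

Lemma dotvC x y : dotv x y = dotv y x.
Proof. by apply: eq_bigr => j _; rewrite mulrC. Qed.

Lemma dotvDl x y z : dotv (x + y) z = dotv x z + dotv y z.
Proof. by rewrite -big_split; apply: eq_bigr => j _; rewrite mxE mulrDl. Qed.

Lemma dotvZl k x y : dotv (k *: x) y = k * dotv x y.
Proof. by rewrite mulr_sumr; apply: eq_bigr => j _; rewrite mxE mulrA. Qed.

Lemma dotvNl x y : dotv (- x) y = - dotv x y.
Proof. by rewrite -scaleN1r dotvZl mulN1r. Qed.

Lemma dotvDr x y z : dotv z (x + y) = dotv z x + dotv z y.
Proof. by rewrite dotvC dotvDl !(dotvC z). Qed.

Lemma dotvZr k x y : dotv y (k *: x) = k * dotv y x.
Proof. by rewrite dotvC dotvZl (dotvC y). Qed.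

Lemma dotvNr x y : dotv y (- x) = - dotv y x.
Proof. by rewrite dotvC dotvNl (dotvC y). Qed.

Definition dotvE := (dotvDl, dotvDr, dotvZl, dotvZr, dotvNl, dotvNr).

Lemma sqnorm_ge0 x : 0 <= sqnorm x.
Proof. by apply: sumr_ge0 => j _; rewrite -expr2 sqr_ge0. Qed.

Lemma sqnorm_eq0 x : sqnorm x = 0 -> x = 0.
Proof.
move=> /eqP; rewrite /sqnorm psumr_eq0; last by move=> j _; rewrite -expr2 sqr_ge0.
move=> /allP H; apply/rowP => j; rewrite mxE; apply/eqP.
by have := H j (mem_index_enum j); rewrite mulf_eq0 orbb.
Qed.

Lemma dotv_cauchy_schwarz x y : dotv x y ^+ 2 <= sqnorm x * sqnorm y.
Proof.
have [y0|y0] := eqVneq (sqnorm y) 0.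
  by rewrite y0 (sqnorm_eq0 y0) -(scale0r (0 : 'rV_n)) dotvZr mul0r expr0n mulr0.
have yp : 0 < sqnorm y by rewrite lt_def y0 sqnorm_ge0.
have := sqnorm_ge0 (sqnorm y *: x - dotv x y *: y).
have -> : sqnorm (sqnorm y *: x - dotv x y *: y) =
    sqnorm y * (sqnorm x * sqnorm y - dotv x y ^+ 2).
  by rewrite {1}/sqnorm !dotvE -!/(sqnorm _) (dotvC y x); ring.
by rewrite pmulr_rge0// subr_ge0.
Qed.

End DotProduct.

Section HorizontalNorm.
Context {R : realType} {n : nat}.
Local Notation E := ('rV[R]_n * R)%type.
Implicit Types p v : E.

Lemma hcombE p (al be : 'I_n -> R) :
  hcomb p al be = (\row_j al j, \sum_(j < n) be j * p.1 0 j).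
Proof.
rewrite /hcomb [LHS]surjective_pairing; congr pair.
  rewrite (big_morph fst (id1 := 0) (op1 := +%R))//= [RHS]row_sum_delta.
  by apply: eq_bigr => j _; rewrite mxE scaler0 addr0.
rewrite (big_morph snd (id1 := 0) (op1 := +%R))//=.
by apply: eq_bigr => j _; rewrite scaler0 add0r.
Qed.

(* Where [p.1 = 0] the quotient is the junk value [0], which is the right one:
   there the second component of a horizontal vector vanishes. *)
Definition hnorm p v : R := Num.sqrt (sqnorm v.1 + v.2 ^+ 2 / sqnorm p.1).

Lemma hnorm_ge0 p v : 0 <= hnorm p v.
Proof. exact: sqrtr_ge0. Qed.

(** In any representation of [v] the coefficients [al] are the entries of [v.1], while [v.2] is the
    dot product of [be] with [p.1]; Cauchy-Schwarz then bounds the squared norm of [be] from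
    below. *)
Lemma hnorm_le_cc_norm p v : ((hnorm p v)%:E <= cc_norm p v)%E.
Proof.
rewrite /cc_norm (_ : (hnorm p v)%:E = sqrte (sqnorm v.1 + v.2 ^+ 2 / sqnorm p.1)%:E)//.
rewrite lee_sqrt; last first.
  apply: le_ereal_inf_tmp => _ [al [be [_ ->]]].
  by rewrite lee_fin sumr_ge0// => j _; rewrite addr_ge0// sqr_ge0.
apply: le_ereal_inf_tmp => _ [al [be [-> ->]]].
rewrite lee_fin hcombE/= big_split/=; apply: lerD.
  by apply: ler_sum => j _; rewrite !mxE expr2.
have [p0|p0] := eqVneq (sqnorm p.1) 0.
  by rewrite p0 invr0 mulr0 sumr_ge0// => j _; rewrite sqr_ge0.
rewrite ler_pdivrMr; last by rewrite lt_def p0 sqnorm_ge0.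
have := dotv_cauchy_schwarz (\row_j be j) p.1.
rewrite (_ : dotv (\row_j be j) p.1 = \sum_(j < n) be j * p.1 0 j).
  rewrite (_ : sqnorm (\row_j be j) = \sum_(j < n) be j ^+ 2)//.
  by apply: eq_bigr => j _; rewrite mxE expr2.
by apply: eq_bigr => j _; rewrite mxE.
Qed.

Lemma cc_norm_hcomb_le p (al be : 'I_n -> R) :
  (cc_norm p (hcomb p al be) <=
   (Num.sqrt (\sum_(j < n) (al j ^+ 2 + be j ^+ 2)))%:E)%E.
Proof.
have H : 0 <= \sum_(j < n) (al j ^+ 2 + be j ^+ 2).
  by rewrite sumr_ge0// => j _; rewrite addr_ge0// sqr_ge0.
rewrite /cc_norm (_ : (Num.sqrt _)%:E =
  sqrte (\sum_(j < n) (al j ^+ 2 + be j ^+ 2))%:E)// lee_sqrt ?lee_fin//.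
by apply: ereal_inf_lbound; exists al, be.
Qed.

(** Cauchy-Schwarz for the pairs [(w, c p.1)] and [(v.1, q p.1)] with [q = v.2 / sqnorm p.1]. It
    will be applied with half the horizontal gradient of [W] as the first pair. *)
Lemma hspan_pairing_le p v (w : 'rV[R]_n) (c : R) : hspan p v ->
  dotv w v.1 + c * v.2 <=
  Num.sqrt (sqnorm w + c ^+ 2 * sqnorm p.1) * hnorm p v.
Proof.
move=> [al [be]]; rewrite hcombE => vE.
have W0 := sqnorm_ge0 w; have V0 := sqnorm_ge0 v.1; have P0 := sqnorm_ge0 p.1.
have CS := dotv_cauchy_schwarz w v.1.
rewrite /hnorm -sqrtrM; last by rewrite addr_ge0// mulr_ge0// sqr_ge0.
apply: (le_trans (ler_norm _)); rewrite -sqrtr_sqr; apply: ler_wsqrtr.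
have [p0|p0] := eqVneq (sqnorm p.1) 0.
  rewrite (_ : v.2 = 0) ?mulr0 ?addr0 ?p0 ?invr0 ?mulr0 ?addr0//.
  by rewrite vE (sqnorm_eq0 p0)/= big1// => j _; rewrite mxE mulr0.
have pp : 0 < sqnorm p.1 by rewrite lt_def p0.
set m := dotv w v.1 in CS *; set W := sqnorm w in CS W0 *.
set X := sqnorm v.1 in CS V0 *; set P := sqnorm p.1 in p0 P0 pp *.
set q := v.2 / P; have -> : v.2 ^+ 2 / P = q ^+ 2 * P by rewrite /q; field.
have -> : v.2 = q * P by rewrite /q mulfVK.
(* The cross terms of the expanded product: the arithmetic-geometric mean inequality combined with
   [m ^+ 2 <= W * X]. *)
have : 2 * (m * (c * q)) <= W * q ^+ 2 + c ^+ 2 * X.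
  apply: (le_trans (ler_norm _)).
  rewrite -(ler_pXn2r (n := 2))// ?nnegrE//; last first.
    by rewrite addr_ge0// mulr_ge0// sqr_ge0.
  rewrite real_normK ?num_real// exprMn exprMn.
  have : m ^+ 2 * (c * q) ^+ 2 <= W * X * (c * q) ^+ 2.
    by rewrite ler_wpM2r// sqr_ge0.
  have := sqr_ge0 (W * q ^+ 2 - c ^+ 2 * X); nra.
move=> /(ler_wpM2r P0); lra. Qed.

End HorizontalNorm.

(** * Reparametrization by arclength *)

Section Primitive.
Context {R : realType}.
Local Notation mu := (@lebesgue_measure R).

(* The library's [ge0_le_integral] asks for measurability of both functions. *)
Lemma ge0_le_integral_nonmeasurable (D1 D2 : set R) (f1 f2 : R -> \bar R) :
  D1 `<=` D2 -> (forall x, D1 x -> 0 <= f1 x)%E -> (forall x, D2 x -> 0 <= f2 x)%E ->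
  (forall x, D1 x -> f1 x <= f2 x)%E ->
  (\int[mu]_(x in D1) f1 x <= \int[mu]_(x in D2) f2 x)%E.
Proof.
move=> D12 f10 f20 f12; rewrite !ge0_integralE//; apply: ge_ereal_sup.
move=> _ [h hf <-]; apply: ereal_sup_ubound; exists h => // x.
apply: (le_trans (hf x)); rewrite !patchE; case: ifPn; rewrite ?inE ?notin_setE => D1x.
  by rewrite mem_set ?f12//; exact: D12.
by case: ifPn => //; rewrite inE => /f20.
Qed.

Variable f : R -> R.
Hypothesis f0 : forall x, 0 <= f x.
Hypothesis intf : mu.-integrable setT (EFin \o f).

Let intf_ (D : set R) : measurable D -> mu.-integrable D (EFin \o f).
Proof. by move=> mD; apply: integrableS intf. Qed.

Let F x : R := \int[mu]_(t in `[0, x]) f t.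

Lemma primitiveB (s t : R) : 0 <= s -> s <= t ->
  F t - F s = \int[mu]_(x in `]s, t[) f x.
Proof.
move=> s0 st; rewrite /F Rintegral_itvB//; first last.
  exact: intf_.
by rewrite -Rintegral_itv_bndo_bndc//; exact: intf_.
Qed.

Lemma primitive_nondecreasing (s t : R) : 0 <= s -> s <= t -> F s <= F t.
Proof.
by move=> s0 st; rewrite -subr_ge0 primitiveB//; apply: Rintegral_ge0.
Qed.

(** The increments add up to the integral over the union of the intervals, which is small because
    the union has small measure. *)
Lemma primitive_ac (b : R) : abs_continuous 0 b F.
Proof.
move=> e e0; have [d [d0 H]] := integral_normr_continuous intf e0.
exists d => // N l r lr tlr lrd.
pose I i : set R := `]l i, r i[%classic.
pose D := \big[setU/set0]_(i <- index_enum 'I_N) I i.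
have mD : measurable D by apply: bigsetU_measurable => i _; exact: measurable_itv.
have muD : (mu D < d%:E)%E.
  rewrite /D measure_bigsetU_ord//; last by move=> i; exact: measurable_itv.
  rewrite (_ : (\sum_(i < N) _)%E = (\sum_(i < N) (r i - l i))%:E) ?lte_fin//.
  rewrite -sumEFin; apply: eq_bigr => i _; apply: lebesgue_measure_itvoo_le.
  by have [_ []] := lr i.
apply: le_lt_trans (H D mD muD).
have Fi i : `|F (r i) - F (l i)| = \int[mu]_(x in I i) `|f x|.
  have [l0 [lri _]] := lr i.
  rewrite primitiveB// ger0_norm ?Rintegral_ge0//.
  by apply: eq_Rintegral => x _; rewrite ger0_norm.
under eq_bigr do rewrite Fi.
have fin (A : set R) : measurable A -> (\int[mu]_(x in A) (`|f x|)%:E)%E \is a fin_num.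
  move=> mA; apply: integrable_fin_num => //.
  by apply/integrable_norm/intf_.
rewrite -lee_fin -sumEFin /Rintegral fineK ?fin//.
rewrite (eq_bigr (fun i => \int[mu]_(x in I i) (`|f x|)%:E)%E); last first.
  by move=> i _; rewrite fineK ?fin//; exact: measurable_itv.
rewrite -ge0_integral_bigsetU//.
- by move=> i; exact: measurable_itv.
- exact: index_enum_uniq.
- by apply: sub_trivIset tlr.
- apply/measurable_EFinP/measurableT_comp => //; apply/measurable_EFinP.
  exact: measurable_int (intf_ mD).
Qed.

Lemma primitive_derive :
  {ae mu, forall x, 0 < x -> derivable F x 1 /\ derive1 F x = f x}.
Proof.
have locf : locally_integrable [set: R] f.
  by have := integrable_locally measurableT intf; rewrite patch_setT.
have := FTC1 (a := BLeft 0) (fun y => intf_ (measurable_itv _)) locf.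
apply: filterS; first exact: (ae_filter_ringOfSetsType mu).
by move=> x H x0; apply: H; rewrite lte_fin.
Qed.

End Primitive.

(** * Coordinates of a curve *)

Section Components.
Context {R : realType} {n : nat}.
Local Notation E := ('rV[R]_n * R)%type.
Implicit Types g : R -> E.

Lemma normr_row_le (x : 'rV[R]_n) j : `|x 0 j| <= `|x|.
Proof.
by rewrite [leRHS]/Num.Def.normr/= mx_normrE (le_bigmax _ (fun ij => `|x ij.1 ij.2|) (0, j)).
Qed.

Lemma ac_coord a b g j :
  abs_continuous a b g -> abs_continuous a b (fun t => (g t).1 0 j).
Proof.
apply: ac_le => s t _ _ _; rewrite (le_trans _ (_ : `|(g t - g s).1| <= _))//.
  by apply: le_trans (normr_row_le _ j); rewrite !mxE.
by rewrite [leRHS]prod_normE le_max lexx.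
Qed.

Lemma ac_snd a b g : abs_continuous a b g -> abs_continuous a b (fun t => (g t).2).
Proof.
apply: ac_le => s t _ _ _; rewrite (le_trans _ (_ : `|(g t - g s).2| <= _))//.
by rewrite [leRHS]prod_normE le_max lexx orbT.
Qed.

Lemma ac_pair a b (x : R -> 'rV[R]_n) (u : R -> R) :
  abs_continuous a b x -> abs_continuous a b u ->
  abs_continuous a b (fun t => (x t, u t)).
Proof.
move=> acx acu; apply: (ac_comb ler01 ler01 acx acu) => s t _ _ _.
by rewrite [leLHS]prod_normE ge_max !mul1r/= lerDl lerDr !normr_ge0.
Qed.

Lemma is_derive_snd g t : derivable g t 1 ->
  is_derive t 1 (fun s => (g s).2) (derive1 g t).2.
Proof.
move=> dg.
have cg : (fun h : R => h^-1 *: (g (h *: (1 : R) + t) - g t)) @ 0^' --> derive1 g t.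
  by rewrite derive1E.
have c2 := cvg_comp _ _ cg (@cvg_snd _ _ _ _ _).
apply: DeriveDef; first by apply/cvg_ex; exists (derive1 g t).2; exact: c2.
by apply/cvg_lim; [exact: Rhausdorff|exact: c2].
Qed.

Lemma is_derive_coord g t j : derivable g t 1 ->
  is_derive t 1 (fun s => (g s).1 0 j) ((derive1 g t).1 0 j).
Proof.
move=> dg.
have cg : (fun h : R => h^-1 *: (g (h *: (1 : R) + t) - g t)) @ 0^' --> derive1 g t.
  by rewrite derive1E.
have c1 := cvg_comp _ _ cg (@cvg_fst _ _ _ _ _).
have d1 : derivable (fun s => (g s).1) t 1.
  by apply/cvg_ex; exists (derive1 g t).1; exact: c1.
have -> : (derive1 g t).1 = 'D_1 (fun s => (g s).1) t
  by apply/esym/cvg_lim; [exact: norm_hausdorff|exact: c1].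
rewrite derive_mx// mxE; apply: derivableP.
by have := (derivable_mxP _ _ _).1 d1 0 j.
Qed.

End Components.

(** * Measurability of absolutely continuous functions and their derivatives *)

Section Measurability.
Context {R : realType}.
Variables (phi : R -> R) (A : set R).
Hypotheses (acphi : abs_continuous 0 1 phi) (mA : measurable A).
Hypothesis A01 : A `<=` `]0, 1[%classic.

Let max0_lipschitz (a b : R) : `|Num.max 0 a - Num.max 0 b| <= `|a - b|.
Proof.
have := ler_norm (a - b); have := ler_norm (b - a); rewrite (distrC b a) ler_norml.
by rewrite /Num.max; case: ltP => a0; case: ltP => b0 ? ?; apply/andP; split; lra.
Qed.

Let min1_lipschitz (a b : R) : `|Num.min 1 a - Num.min 1 b| <= `|a - b|.
Proof.
have := ler_norm (a - b); have := ler_norm (b - a); rewrite (distrC b a) ler_norml.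
by rewrite /Num.min; case: ltP => a0; case: ltP => b0 ? ?; apply/andP; split; lra.
Qed.

(** The constant extension of [phi] beyond [[0, 1]]: it is continuous on the whole line, hence
    measurable. *)
Let psi t := phi (Num.max 0 (Num.min t 1)).

Let psiE t : 0 <= t <= 1 -> psi t = phi t.
Proof. by move=> /andP[t0 t1]; rewrite /psi min_l// max_r. Qed.

Let mpsi : measurable_fun [set: R] psi.
Proof.
apply: continuous_measurable_fun => t; apply/cvgrPdist_lt => e e0.
have [d d0 H] := ac_continuous acphi e0.
near=> s; apply: H.
- by rewrite le_max lexx ge_max ler01 ge_min lexx orbT.
- by rewrite le_max lexx ge_max ler01 ge_min lexx orbT.
apply: (@le_lt_trans _ _ `|t - s|).
  rewrite (le_trans (max0_lipschitz _ _))// !(minC _ 1); exact: min1_lipschitz.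
by near: s; exact: cvgr_dist_lt.
Unshelve. all: by end_near. Qed.

Lemma measurable_ac : measurable_fun A phi.
Proof.
apply: (eq_measurable_fun psi); last exact: measurable_funTS.
by move=> t; rewrite inE => /A01; rewrite /= in_itv/= => /andP[t0 t1]; rewrite psiE// !ltW.
Qed.

(** The derivative is the pointwise limit of the difference quotients of [psi] with steps
    [1 / (m + 1)]. As [t < 1], for large [m] they only involve points of [[0, 1]], where [psi] is
    [phi]. *)
Lemma measurable_derive_ac : (forall t, A t -> derivable phi t 1) ->
  measurable_fun A (derive1 phi).
Proof.
move=> dphi.
pose h (m : nat) (t : R) := m.+1%:R * (psi (m.+1%:R^-1 + t) - psi t).
apply: (@measurable_fun_cvg _ _ R A h).
  move=> m; apply: measurable_funTS.
  apply: measurable_funM => //; apply: measurable_funB => //.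
  by apply: (measurableT_comp mpsi); apply: measurable_funD.
move=> t At; have /= := A01 At; rewrite in_itv/= => /andP[t0 t1].
have H : (fun h : R => h^-1 *: (phi (h *: (1 : R) + t) - phi t)) @ 0^' --> derive1 phi t.
  by rewrite derive1E; exact: dphi.
apply/cvgrPdist_lt => e e0; move/cvgrPdist_lt : H => /(_ e e0)[d/= d0 H].
near=> m.
have md : m.+1%:R^-1 < d by near: m; exact: near_infty_natSinv_lt (PosNum d0).
have mt : m.+1%:R^-1 < 1 - t.
  near: m; have t10 : 0 < 1 - t by [rewrite subr_gt0].
  exact: near_infty_natSinv_lt (PosNum t10).
have := H m.+1%:R^-1; rewrite /ball_/= sub0r normrN gtr0_norm// invrK [_ *: (1 : R)]mulr1.
rewrite /h !psiE//; first by apply => //; rewrite gt_eqF.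
  by rewrite !ltW.
by rewrite addr_ge0 ?(ltW t0)//= -lerBrDr ltW.
Unshelve. all: by end_near. Qed.

End Measurability.

Section ArclengthTime.
Context {R : realType} {n : nat}.
Local Notation E := ('rV[R]_n * R)%type.
Local Notation mu := (@lebesgue_measure R).

Lemma measurable_hnorm (g : R -> E) (A : set R) :
  abs_continuous 0 1 g -> measurable A -> A `<=` `]0, 1[%classic ->
  (forall t, A t -> derivable g t 1) ->
  measurable_fun A (fun t => hnorm (g t) (derive1 g t)).
Proof.
move=> acg mA A01 dg.
have mx j : measurable_fun A (fun t => (g t).1 0 j).
  exact: measurable_ac (ac_coord j acg) A01.
have mdx j : measurable_fun A (fun t => (derive1 g t).1 0 j).
  apply: (eq_measurable_fun (derive1 (fun t => (g t).1 0 j))).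
    by move=> t; rewrite inE => /dg/(is_derive_coord j) H; rewrite derive1E derive_val.
  apply: measurable_derive_ac (ac_coord j acg) A01 _ => t /dg/(is_derive_coord j) H.
  exact: ex_derive.
have mdu : measurable_fun A (fun t => (derive1 g t).2).
  apply: (eq_measurable_fun (derive1 (fun t => (g t).2))).
    by move=> t; rewrite inE => /dg/is_derive_snd H; rewrite derive1E derive_val.
  apply: measurable_derive_ac (ac_snd acg) A01 _ => t /dg/is_derive_snd H.
  exact: ex_derive.
have msq (x : R -> 'rV[R]_n) : (forall j, measurable_fun A (fun t => x t 0 j)) ->
    measurable_fun A (fun t => sqnorm (x t)).
  by move=> mxj; apply: measurable_sum => j; apply: measurable_funM.
apply: (measurableT_comp (continuous_measurable_fun (@sqrt_continuous R))).
apply: measurable_funD; first exact: msq.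
apply: measurable_funM; first exact: measurable_funX.
(* On nonnegative reals the inverse is the power [-1], the value [0] at [0] included, and powers are
   measurable. *)
rewrite (_ : (fun t => _) = fun t => (sqnorm (g t).1) `^ (-1)).
  by apply: (measurableT_comp (measurable_powR _)); exact: msq.
by apply/funext => t; rewrite powR_inv1 ?sqnorm_ge0.
Qed.

(** Up to a linear correction, [s] is the arclength divided by [L]. It is a clock along the given
    curve rather than a new parameter, so the arclength is never inverted. *)
Lemma arclength_time (g : R -> E) (L : R) :
  horizontal g -> (cc_length g < L%:E)%E ->
  exists s : R -> R, [/\ abs_continuous 0 1 s, s 0 = 0, s 1 = 1,
    forall t, 0 <= t <= 1 -> 0 <= s t <= 1 &
    {ae mu, forall t, t \in `[0, 1] ->
      [/\ derivable g t 1, hspan (g t) (derive1 g t), derivable s t 1 &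
          hnorm (g t) (derive1 g t) <= L * derive1 s t]}].
Proof.
move=> [acg [N [mN N0 gN]]] lenL.
(* Every point of [A] is a point of differentiability, so the speed is measurable on [A]; its
   complement in [[0, 1]] is null. *)
pose A := `]0, 1[%classic `\` N.
have mA : measurable A by apply: measurableD => //; exact: measurable_itv.
have A01 : A `<=` `]0, 1[%classic by move=> t [].
have Ag t : A t -> derivable g t 1 /\ hspan (g t) (derive1 g t).
  move=> [t01 Nt]; apply: contrapT => H; apply/Nt/gN => /=; apply: contra_not H; apply.
  by move: t01; rewrite /= !in_itv/= => /andP[t0 t1]; rewrite !ltW.
have mh : measurable_fun A (fun t => hnorm (g t) (derive1 g t)).
  by apply: measurable_hnorm => // t /Ag[].
pose f : R -> R := (fun t => hnorm (g t) (derive1 g t)) \_ A.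
have f0 t : 0 <= f t by rewrite /f patchE; case: ifP => // _; exact: hnorm_ge0.
have fL : (\int[mu]_t (f t)%:E < L%:E)%E.
  apply: le_lt_trans lenL.
  rewrite (_ : (\int[mu]_t _)%E = (\int[mu]_(t in A) (hnorm (g t) (derive1 g t))%:E)%E).
    apply: ge0_le_integral_nonmeasurable.
    - by move=> t /A01/=; rewrite !in_itv/= => /andP[t0 t1]; rewrite !ltW.
    - by move=> t _; rewrite lee_fin hnorm_ge0.
    - by move=> t _; exact: sqrte_ge0.
    - by move=> t _; exact: hnorm_le_cc_norm.
  rewrite [RHS]integral_mkcond; apply: eq_integral => t _.
  by rewrite /f !patchE; case: ifP.
have mf : measurable_fun setT f.
  have := (measurable_restrictT (fun t => hnorm (g t) (derive1 g t)) mA).1 mh.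
  by apply: eq_measurable_fun => t _; rewrite /f !patchE; case: ifP.
have intf : mu.-integrable setT (EFin \o f).
  apply/integrableP; split; first exact/measurable_EFinP.
  under eq_integral do rewrite /= ger0_norm//.
  by apply: lt_le_trans fL _; exact: leey.
pose F x : R := \int[mu]_(t in `[0, x]) f t.
have F0 : F 0 = 0 by rewrite /F set_itv1 Rintegral_set1.
have F1L : F 1 < L.
  rewrite -lte_fin; apply: le_lt_trans fL.
  rewrite /F /Rintegral fineK; last first.
    by apply: integrable_fin_num => //; exact: integrableS intf.
  by apply: ge0_subset_integral => //; [exact/measurable_EFinP|move=> x _; rewrite lee_fin f0].
have F1p : 0 <= F 1.
  by rewrite -F0; apply: primitive_nondecreasing => //; exact: ler01.
have L0 : 0 < L by exact: le_lt_trans F1L.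
(* The multiple of [t] makes up for [F 1 < L], so that [sg 1 = 1]. *)
pose sg (t : R) : R := L^-1 * F t + (1 - F 1 / L) * t.
exists sg; rewrite /sg; split.
- apply: acD; first by apply: acZ; exact: primitive_ac.
  apply: acZ; apply: (@ac_lipschitz _ _ _ _ _ 1) => // s t _ st _.
  by rewrite mul1r ger0_norm// subr_ge0.
- by rewrite F0 !mulr0 addr0.
- by rewrite mulr1 mulrC addrC subrK.
- move=> t /andP[t0 t1].
  have Ft0 : 0 <= F t by rewrite -F0; apply: primitive_nondecreasing.
  have Ft1 : F t <= F 1 by apply: primitive_nondecreasing.
  have FL1 : 0 <= 1 - F 1 / L by rewrite subr_ge0 ler_pdivrMr// mul1r ltW.
  rewrite addr_ge0 ?mulr_ge0 ?invr_ge0 ?(ltW L0)//=.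
  rewrite -[leRHS](subrK (F 1 / L)) addrC lerD//.
    by rewrite -[leRHS]mulr1 ler_wpM2l.
  by rewrite mulrC ler_wpM2r// invr_ge0 ltW.
have aeF := primitive_derive intf.
have aeN : {ae mu, forall t, ~ N t}.
  by exists N; split => // t /= /contrapT.
have ae0 (x : R) : {ae mu, forall t, t <> x}.
  by exists [set x]; split => //; [exact: lebesgue_measure_set1|move=> t /= /contrapT].
have FF := ae_filter_ringOfSetsType mu.
near=> t => t01.
have At : A t.
  split; last by near: t.
  move: t01; rewrite /= !in_itv/= !le_eqVlt => /andP[/predU1P[t0|->]/predU1P[t1|->]]//.
  - have /(_ _)[] : t <> 0 by near: t.
    by rewrite t0.
  - have /(_ _)[] : t <> 0 by near: t.
    by rewrite t0.
  - have /(_ _)[] : t <> 1 by near: t.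
    by rewrite t1.
have [dg hg] := Ag t At.
have t0 : 0 < t by move: (A01 _ At); rewrite /= in_itv/= => /andP[].
have [dF F't] : derivable F t 1 /\ derive1 F t = f t by move: t0; near: t.
have idF : is_derive t 1 F (f t) by rewrite -F't derive1E; exact: derivableP.
have ids : is_derive t (1 : R) sg (L^-1 * f t + (1 - F 1 / L)).
  by apply: is_derive_eq; rewrite /GRing.scale/= mulr1.
case: ids => ds Es; split => //; rewrite -/sg.
rewrite [derive1 sg t]derive1E Es mulrDr mulrA mulfV ?gt_eqF// mul1r.
rewrite /f patchE mem_set// lerDl mulr_ge0 ?(ltW L0)//.
by rewrite subr_ge0 ler_pdivrMr// mul1r ltW.
Unshelve. all: by end_near. Qed.

End ArclengthTime.

(** * Lower bound *)

Section Lipschitz.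
Context {R : realType}.
Variables (f df : R -> R) (a b : R).
Hypothesis fdf : forall x, a <= x <= b -> is_derive x 1 f (df x).

Let cf : {within `[a, b], continuous f}.
Proof.
apply: derivable_within_continuous => x; rewrite in_itv/= => xab.
by have := fdf xab => H; exact: ex_derive.
Qed.

Lemma derivable_bounded : a <= b ->
  exists2 M, 0 <= M & forall x, a <= x <= b -> `|f x| <= M.
Proof.
move=> ab; have cnf : {within `[a, b], continuous (fun x => `|f x|)}.
  by move=> x; apply: continuous_comp; [exact: cf|exact: norm_continuous].
have [c _ cM] := EVT_max ab cnf.
by exists `|f c| => // x xab; apply: cM; rewrite in_itv.
Qed.

Lemma lipschitz_le_derive (k : R) : (forall x, a <= x <= b -> `|df x| <= k) ->
  forall x y, a <= x <= b -> a <= y <= b -> `|f y - f x| <= k * `|y - x|.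
Proof.
move=> dfk x y; wlog xy : x y / x <= y => [hw|] xab yab.
  have [|yx] := leP x y; first by move=> xy; exact: hw.
  by rewrite distrC (distrC y); apply: hw => //; exact: ltW.
have [||c] := @MVT_segment R f df x y xy.
- by move=> z; rewrite in_itv/= => zxy; apply: fdf; lra.
- apply: continuous_subspaceW cf => z /=; rewrite !in_itv/=; lra.
rewrite in_itv/= => cxy ->; rewrite normrM ler_wpM2r// dfk//; lra.
Qed.

End Lipschitz.

Section Calibration.
Context {R : realType} {n : nat}.
Local Notation E := ('rV[R]_n * R)%type.

Lemma is_derive_dotv (x y : R -> 'rV[R]_n) (dx dy : 'rV[R]_n) (t : R) :
  (forall j, is_derive t 1 (fun s => x s 0 j) (dx 0 j)) ->
  (forall j, is_derive t 1 (fun s => y s 0 j) (dy 0 j)) ->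
  is_derive t 1 (fun s => dotv (x s) (y s)) (dotv dx (y t) + dotv (x t) dy).
Proof.
move=> xdx ydy; rewrite /dotv -big_split/=.
rewrite (_ : (fun s => _) = \sum_(j < n) (fun s => x s 0 j * y s 0 j)); last first.
  by apply/funext => s; rewrite fct_sumE.
apply: is_derive_sum => j; have := xdx j; have := ydy j => ? ?.
by apply: is_derive_eq; rewrite /GRing.scale/= addrC; congr (_ + _); rewrite mulrC.
Qed.

Variables (b : R) (v : 'rV[R]_n) (T al : R -> R).
Hypothesis dT : forall s : R, 0 <= s <= 1 -> is_derive s 1 T (al s ^+ 2).
Hypothesis dal : forall s : R, 0 <= s <= 1 -> is_derive s 1 al (b ^+ 2 * T s * al s).
Hypothesis alT : forall s : R, 0 <= s <= 1 -> al s ^+ 2 = 1 + b ^+ 2 * T s ^+ 2.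

(* A solution of the Hamilton-Jacobi equation
   [W_s + (sum_j ((X_j W)^2 + (U_j W)^2)) / 4 = 0]. *)
Let W s (p : E) :=
  2 * b * p.2 - b ^+ 2 * (T s * sqnorm p.1) + 2 * (al s * dotv v p.1) - sqnorm v * T s.

(** With [G] a quarter of the squared horizontal gradient of [W], the Hamilton-Jacobi equation turns
    the derivative of [h] into [2 (<w, x'> + b u') - (G + L^2) s']. The pairing is at most [sqrt G]
    times the speed, hence at most [sqrt G L s'], and [2 sqrt G L <= G + L^2]. *)
Lemma calibration (g : R -> E) (L : R) :
  horizontal g -> (cc_length g < L%:E)%E ->
  W 1 (g 1) - W 0 (g 0) <= L ^+ 2.
Proof.
move=> hg gL; have [s [acs s0 s1 s01 aes]] := arclength_time hg gL.
have L0 : 0 < L.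
  rewrite -lte_fin; apply: le_lt_trans gL.
  by apply: integral_ge0 => t _; exact: sqrte_ge0.
pose h t := W (s t) (g t) - L ^+ 2 * s t.
suff : h 1 <= h 0 by rewrite /h s0 s1 mulr1 mulr0 subr0; lra.
have le01 : (0 : R) <= 1 := ler01.
have [acg _] := hg.
have [M M0 alM] := derivable_bounded dal le01.
have [K K0 TK] := derivable_bounded dT le01.
have acT : abs_continuous 0 1 (T \o s).
  apply: (ac_comp_lipschitz (sqr_ge0 M) s01 _ acs).
  apply: (lipschitz_le_derive dT) => t t01.
  by rewrite normrX lerXn2r ?nnegrE// alM.
have acal : abs_continuous 0 1 (al \o s).
  have kM0 : 0 <= b ^+ 2 * K * M by rewrite mulr_ge0// mulr_ge0// sqr_ge0.
  apply: (ac_comp_lipschitz kM0 s01 _ acs).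
  apply: (lipschitz_le_derive dal) => t t01.
  rewrite normrM normrM (ger0_norm (sqr_ge0 b)) ler_pM ?alM//.
    by rewrite mulr_ge0// sqr_ge0.
  by rewrite ler_wpM2l ?sqr_ge0// TK.
apply: (@ac_le0_derive R h 0 1) => //.
  rewrite /h /W; apply: acB; last exact: acZ.
  apply: acB; last exact: acZ.
  apply: acD; last first.
    apply/acZ/acM => //; apply: ac_sum => j; apply: acZ; exact: ac_coord.
  apply: acB; first by apply: acZ; exact: ac_snd.
  by apply/acZ/acM => //; apply: ac_sum => j; apply: acM => //; exact: ac_coord.
have FF := ae_filter_ringOfSetsType (@lebesgue_measure R).
apply: filterS aes => t Ht t01; have [dg hgt ds] := Ht t01.
set p := g t in hgt *; set p' := derive1 g t in hgt *.
set s' := derive1 s t => lens.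
have st01 : 0 <= s t <= 1 by apply: s01; move: t01; rewrite in_itv.
have is_s : is_derive t (1 : R) s s' by rewrite /s' derive1E; exact: derivableP.
have isT : is_derive t (1 : R) (T \o s) (al (s t) ^+ 2 * s').
  by apply: is_derive1_comp; exact: dT.
have isal : is_derive t (1 : R) (al \o s) (b ^+ 2 * T (s t) * al (s t) * s').
  by apply: is_derive1_comp; exact: dal.
have isu : is_derive t (1 : R) (fun t => (g t).2) p'.2 by exact: is_derive_snd.
have isx j : is_derive t (1 : R) (fun t => (g t).1 0 j) (p'.1 0 j).
  exact: is_derive_coord.
have isq : is_derive t (1 : R) (fun t => sqnorm (g t).1) (2 * dotv p.1 p'.1).
  have := is_derive_dotv isx isx; rewrite (dotvC p'.1) => H.
  by apply: is_derive_eq; rewrite -mulr2n mulr_natl.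
have isv : is_derive t (1 : R) (fun t => dotv v (g t).1) (dotv v p'.1).
  have isv0 j : is_derive t (1 : R) (fun=> v 0 j) ((0 : 'rV[R]_n) 0 j).
    by rewrite mxE; exact: is_derive_cst.
  have := is_derive_dotv isv0 isx => H; apply: is_derive_eq.
  by rewrite -(scale0r (0 : 'rV_n)) dotvZl mul0r add0r.
(* Half the horizontal gradient of [W]: [X_j W] is twice the entry [j] of [w], and [U_j W] is [2 b]
   times that of [p.1]. *)
pose w := (- (b ^+ 2 * T (s t))) *: p.1 + al (s t) *: v.
pose G := sqnorm w + b ^+ 2 * sqnorm p.1.
have ish : is_derive t (1 : R) h (2 * (dotv w p'.1 + b * p'.2) - (G + L ^+ 2) * s').
  rewrite /h /W; apply: is_derive_eq.
rewrite /GRing.scale/= -/p.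
  have -> : G = (b ^+ 2 * T (s t)) ^+ 2 * sqnorm p.1 + al (s t) ^+ 2 * sqnorm v
      - 2 * (b ^+ 2 * T (s t) * al (s t)) * dotv v p.1 + b ^+ 2 * sqnorm p.1.
    by rewrite /G /w /sqnorm !dotvE (dotvC p.1 v); ring.
  have -> : dotv w p'.1 = al (s t) * dotv v p'.1 - b ^+ 2 * T (s t) * dotv p.1 p'.1.
    by rewrite /w !dotvE; ring.
  (* The last term collects the defect in the Hamilton-Jacobi equation, which [alT] cancels. *)
  transitivity (2 * (al (s t) * dotv v p'.1 - b ^+ 2 * T (s t) * dotv p.1 p'.1 +
        b * p'.2) -
      ((b ^+ 2 * T (s t)) ^+ 2 * sqnorm p.1 + al (s t) ^+ 2 * sqnorm v -
       2 * (b ^+ 2 * T (s t) * al (s t)) * dotv v p.1 + b ^+ 2 * sqnorm p.1 +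
       L ^+ 2) * s' -
      b ^+ 2 * sqnorm p.1 * s' * (al (s t) ^+ 2 - (1 + b ^+ 2 * T (s t) ^+ 2))).
    by ring.
  by rewrite alT// subrr mulr0 subr0.
case: ish => dh Eh; split => //; rewrite derive1E Eh.
have s'0 : 0 <= s'.
  by rewrite -(pmulr_rge0 _ L0); apply: le_trans lens; exact: hnorm_ge0.
have G0 : 0 <= G by rewrite addr_ge0 ?sqnorm_ge0// mulr_ge0 ?sqnorm_ge0 ?sqr_ge0.
have := hspan_pairing_le w b hgt; rewrite -/G => wG.
have : Num.sqrt G * hnorm p p' <= Num.sqrt G * (L * s').
  by rewrite ler_wpM2l// sqrtr_ge0.
(* This square gives [2 sqrt G L s' <= (G + L^2) s']. *)
have : 0 <= s' * (Num.sqrt G - L) ^+ 2 by rewrite mulr_ge0// sqr_ge0.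
rewrite -{4}(sqr_sqrtr G0); move: wG; nra.
Qed.

End Calibration.

Section LowerBound.
Context {R : realType}.
Implicit Types b s : R.

Lemma sin_half b : sin b = 2 * sin (b / 2) * cos (b / 2).
Proof. by rewrite {1}(splitr b) sinD; ring. Qed.

Lemma cos_half b : cos b = cos (b / 2) ^+ 2 - sin (b / 2) ^+ 2.
Proof. by rewrite {1}(splitr b) cosD; ring. Qed.

Lemma cos_half_gt0 b : - pi < b < pi -> 0 < cos (b / 2).
Proof. by move=> bpi; apply: cos_gt0_pihalf; lra. Qed.

Lemma sin_half_neq0 b : - pi < b < pi -> b != 0 -> sin (b / 2) != 0.
Proof.
move=> bpi; rewrite neq_lt => /orP[b0|b0].
  by rewrite -oppr_eq0 -sinN gt_eqF// sin_gt0_pihalf//; lra.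
by rewrite gt_eqF// sin_gt0_pihalf//; lra.
Qed.

(** Centring the time at [1 / 2] keeps the angle [b (s - 1 / 2)] in [(- pi / 2, pi / 2)] on [[0, 1]]
    for every [|b| < pi]. The value at [b = 0] is the limit. *)
Definition tan_time b s := if b == 0 then s - 1 / 2 else tan (b * (s - 1 / 2)) / b.
Definition sec_time b s := (cos (b * (s - 1 / 2)))^-1.

Section Derivatives.
Variable b : R.
Hypothesis bpi : - pi < b < pi.

Let cos_time_gt0 s : 0 <= s <= 1 -> 0 < cos (b * (s - 1 / 2)).
Proof.
move=> s01; apply: cos_gt0_pihalf; rewrite -ltr_norml normrM.
have s2 : `|s - 1 / 2| <= 1 / 2 by rewrite ler_norml; lra.
apply: (le_lt_trans (ler_wpM2l (normr_ge0 b) s2)).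
by rewrite mul1r ltr_pM2r ?invr_gt0// ltr_norml.
Qed.

Let is_derive_arg s : is_derive s (1 : R) (fun s => b * (s - 1 / 2)) b.
Proof. by apply: is_derive_eq; rewrite /GRing.scale/= subr0 mulr1. Qed.

Lemma is_derive_tan_time s : 0 <= s <= 1 ->
  is_derive s (1 : R) (tan_time b) (sec_time b s ^+ 2).
Proof.
move=> s01; have c0 := cos_time_gt0 s01; rewrite /sec_time /tan_time.
have [b0|b0] := eqVneq b 0.
  by apply: is_derive_eq; rewrite b0 mul0r cos0 invr1 expr1n subr0.
have dtan := is_derive_tan (lt0r_neq0 c0).
have H : is_derive s (1 : R) (tan \o (fun s => b * (s - 1 / 2)))
    ((cos (b * (s - 1 / 2))) ^- 2 * b) by apply: is_derive1_comp.
rewrite (_ : (fun s => _) = b^-1 *: (tan \o (fun s => b * (s - 1 / 2)))); last first.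
  by apply/funext => t; rewrite /= mulrC.
by apply: is_derive_eq; rewrite /GRing.scale/= exprVn mulrCA mulVf ?mulr1.
Qed.

Lemma is_derive_sec_time s : 0 <= s <= 1 ->
  is_derive s (1 : R) (sec_time b) (b ^+ 2 * tan_time b s * sec_time b s).
Proof.
move=> s01; have c0 := lt0r_neq0 (cos_time_gt0 s01).
have H : is_derive s (1 : R) (cos \o (fun s => b * (s - 1 / 2)))
    (- sin (b * (s - 1 / 2)) * b) by apply: is_derive1_comp.
have K := @is_deriveV R (cos \o (fun s => b * (s - 1 / 2))) s _ 1 c0 H.
apply: (is_derive_eq K).
rewrite /sec_time /tan_time /tan /GRing.scale/=.
by case: eqVneq => [->|b0]; [rewrite expr0n !mul0r !mulr0|field; rewrite c0 b0].
Qed.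

Lemma sec_tan_time s : 0 <= s <= 1 ->
  sec_time b s ^+ 2 = 1 + b ^+ 2 * tan_time b s ^+ 2.
Proof.
move=> s01; have c0 := lt0r_neq0 (cos_time_gt0 s01); rewrite /sec_time /tan_time.
have [->|b0] := eqVneq b 0; first by rewrite mul0r cos0 invr1 !expr1n expr0n mul0r addr0.
by rewrite exprVn cos2_tan2//; field.
Qed.

End Derivatives.

Context {n : nat}.
Local Notation E := ('rV[R]_n * R)%type.

(** For [|b| < pi], the maximum over [v] of [W 1 q - W 0 p], a lower bound for the squared
    distance. *)
Definition dual_energy b (p q : E) : R :=
  2 * b * (q.2 - p.2) + (sqnorm p.1 + sqnorm q.1) * b_cot b
  - 2 * dotv p.1 q.1 * b_over_sin b.

Lemma dual_energy_le (b L : R) (g : R -> E) : - pi < b < pi ->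
  horizontal g -> (cc_length g < L%:E)%E ->
  dual_energy b (g 0) (g 1) <= L ^+ 2.
Proof.
move=> bpi hg gL.
have c0 := lt0r_neq0 (cos_half_gt0 bpi).
have c2s2 := cos2Dsin2 (b / 2).
(* This [v] maximizes the left-hand side of [calibration]. *)
pose v := (sec_time b 1 / (2 * tan_time b 1)) *: ((g 1).1 - (g 0).1).
have := calibration v (is_derive_tan_time bpi) (is_derive_sec_time bpi)
  (sec_tan_time bpi) hg gL.
rewrite /= (_ : sec_time b 0 = sec_time b 1); last first.
  by rewrite /sec_time -cosN; congr (cos _)^-1; field.
rewrite (_ : tan_time b 0 = - tan_time b 1); last first.
  rewrite /tan_time; case: ifP => _; first by field.
  by rewrite (_ : b * (0 - 1 / 2) = - (b * (1 - 1 / 2))) ?tanN ?mulNr//; field.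
have t10 : tan_time b 1 != 0.
  rewrite /tan_time; have [b0|b0] := eqVneq b 0; first by lra.
  rewrite (_ : b * _ = b / 2); last by field.
  by rewrite mulf_neq0 ?invr_eq0// /tan mulf_neq0 ?invr_eq0// sin_half_neq0.
apply: le_trans; rewrite le_eqVlt; apply/orP; left; apply/eqP.
rewrite /v /sqnorm !dotvE -!/(sqnorm _) (dotvC (g 1).1 (g 0).1) /dual_energy.
move: (dotv (g 0).1 (g 1).1) (sqnorm (g 0).1) (sqnorm (g 1).1) (g 1).2 (g 0).2 => d X Y y x.
move: t10; rewrite /b_cot /b_over_sin /tan_time /sec_time.
rewrite (_ : b * (1 - 1 / 2) = b / 2); last by field.
have [->|b0] := eqVneq b 0 => t10.
  by rewrite mul0r cos0; field.
have s0 := sin_half_neq0 bpi b0.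
rewrite /cot /tan (sin_half b) (cos_half b).
move: (cos (b / 2)) (sin (b / 2)) c0 s0 c2s2 => c s c0 s0 cs.
have -> : c ^+ 2 = 1 - s ^+ 2 by rewrite -cs addrK.
by field; rewrite b0 c0 s0.
Qed.

Lemma dual_energy_le_d_CC (b : R) (p q : E) : - pi < b < pi ->
  ((Num.sqrt (dual_energy b p q))%:E <= d_CC p q)%E.
Proof.
move=> bpi; apply: le_ereal_inf_tmp => _ [g [hg [<- <-]] <-].
set r := Num.sqrt _; rewrite leNgt; apply/negP => gr.
have g0 : (0 <= cc_length g)%E by apply: integral_ge0 => t _; exact: sqrte_ge0.
have gfin : cc_length g \is a fin_num.
  by rewrite ge0_fin_numE// (lt_trans gr) ?ltry.
move: gr g0; rewrite -(fineK gfin) lte_fin lee_fin => gr g0.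
(* [dual_energy_le] asks for an [L] strictly above the length; the midpoint is still below [r]. *)
pose L := (fine (cc_length g) + r) / 2.
have Lr : L < r by rewrite /L; lra.
have : dual_energy b (g 0) (g 1) <= L ^+ 2.
  by apply: dual_energy_le => //; rewrite -(fineK gfin) lte_fin /L; lra.
have L0 : 0 <= L by rewrite /L; lra.
have /lt_le_trans : 0 < r by lra.
move: Lr; rewrite /r; case: (lerP 0 (dual_energy b (g 0) (g 1))) => d0 Lr rp dL.
  have := ler_wsqrtr dL; rewrite sqrtr_sqr ger0_norm//; lra.
(* A negative energy has square root [0], which contradicts [0 <= L < r]. *)
by move: Lr; rewrite ltr0_sqrtr//; lra.
Qed.

End LowerBound.

(** * Upper bound *)

Section UpperBound.
Context {R : realType} {n : nat}.
Local Notation E := ('rV[R]_n * R)%type.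

Lemma derivable_pair (x : R -> 'rV[R]_n) (u : R -> R) (t : R) :
  derivable x t 1 -> derivable u t 1 -> derivable (fun s => (x s, u s)) t 1.
Proof.
move=> /cvg_ex[/= dx xdx] /cvg_ex[/= du udu]; apply/cvg_ex; exists (dx, du).
exact: cvg_pair xdx udu.
Qed.

Variables (b c : R) (x xi : R -> 'rV[R]_n) (u : R -> R).
Hypothesis c0 : 0 <= c.
Hypothesis dx : forall (t : R) j, is_derive t 1 (fun s => x s 0 j) (xi t 0 j).
Hypothesis du : forall t : R, is_derive t 1 u (b * sqnorm (x t)).
Hypothesis energy : forall t, sqnorm (xi t) + b ^+ 2 * sqnorm (x t) = c ^+ 2.

Let g t : E := (x t, u t).

Let dg t : derivable g t 1.
Proof.
apply: derivable_pair; last by have := du t => H; exact: ex_derive.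
by apply/derivable_mxP => i j; rewrite ord1; have := dx t j => H; exact: ex_derive.
Qed.

Let g'E t : derive1 g t = hcomb (g t) (fun j => xi t 0 j) (fun j => b * x t 0 j).
Proof.
rewrite hcombE [LHS]surjective_pairing; congr pair.
  apply/rowP => j; rewrite mxE; case: (is_derive_coord j (@dg t)) => _ <-.
  by case: (dx t j).
case: (is_derive_snd (@dg t)) => _ <-; case: (du t) => _ ->.
by rewrite mulr_sumr; apply: eq_bigr => j _; rewrite mulrA.
Qed.

Let lipschitz_x j s t : `|x t 0 j - x s 0 j| <= c * `|t - s|.
Proof.
pose a := Num.min s t; pose d := Num.max s t.
apply: (@lipschitz_le_derive R (fun s => x s 0 j) (fun s => xi s 0 j) a d) => //.
- move=> r _; rewrite -(ler_pXn2r (n := 2))// ?nnegrE// real_normK ?num_real//.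
  rewrite -(energy r) -[leLHS]addr0 lerD//; last first.
    by rewrite mulr_ge0 ?sqnorm_ge0// sqr_ge0.
  rewrite /sqnorm /dotv (bigD1 j)//= -expr2 lerDl sumr_ge0// => i _.
  by rewrite -expr2 sqr_ge0.
- by rewrite /a /d ge_min le_max lexx.
- by rewrite /a /d ge_min le_max lexx !orbT.
Qed.

Let ac_x : abs_continuous 0 1 x.
Proof.
apply: (@ac_lipschitz _ _ _ _ _ c) => // s t _ st _.
rewrite [leLHS]/Num.Def.normr/= mx_normrE; apply: bigmax_le.
  by rewrite mulr_ge0// subr_ge0.
move=> [i j] _ /=; rewrite !mxE ord1; apply: le_trans (lipschitz_x j s t) _.
by rewrite ger0_norm// subr_ge0.
Qed.

Let ac_u : abs_continuous 0 1 u.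
Proof.
(* By [energy], the derivative [b |x|^2] of [u] is at most [c^2 / |b|] in absolute value; for
   [b = 0] both are [0] by the convention on division. *)
have k0 : 0 <= c ^+ 2 / `|b| by rewrite divr_ge0// sqr_ge0.
apply: (ac_lipschitz k0) => s t _ st _; rewrite -(@ger0_norm _ (t - s)) ?subr_ge0//.
apply: (@lipschitz_le_derive R u (fun s => b * sqnorm (x s)) s t) => //; last 2 first.
- by rewrite lexx.
- by rewrite st lexx.
move=> r _; have [->|b0] := eqVneq b 0; first by rewrite mul0r normr0 invr0 mulr0.
rewrite normrM (ger0_norm (sqnorm_ge0 _)) ler_pdivlMr ?normr_gt0//.
rewrite -(energy r) mulrAC -expr2 real_normK ?num_real//.
by rewrite lerDr sqnorm_ge0.
Qed.

(** The velocity has coefficients [xi] along the [X_j] and [b x] along the [U_j], whose squares add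
    up to [c^2] by [energy]. *)
Lemma d_CC_le_speed : (d_CC (x 0, u 0) (x 1, u 1) <= c%:E)%E.
Proof.
apply: (@le_trans _ _ (cc_length g)).
  apply: ereal_inf_lbound; exists g => //; split => //; split; first exact: ac_pair.
  apply: aeW => t _; split => //.
  by exists (fun j => xi t 0 j), (fun j => b * x t 0 j).
have -> : c%:E = (\int[@lebesgue_measure R]_(t in `[0%R, 1%R]) c%:E)%E.
  by rewrite integral_cst//= lebesgue_measure_itv/= lte_fin ltr01 oppr0 adde0 mule1.
apply: ge0_le_integral_nonmeasurable => // t _; first exact: sqrte_ge0.
rewrite g'E; apply: (le_trans (cc_norm_hcomb_le _ _ _)).
rewrite lee_fin (_ : \sum_(j < n) _ = c ^+ 2); first by rewrite sqrtr_sqr ger0_norm.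
rewrite -(energy t) big_split/= /sqnorm /dotv mulr_sumr; congr (_ + _).
by apply: eq_bigr => j _; rewrite exprMn (expr2 (x t 0 j)).
Qed.

End UpperBound.

Section Geodesics.
Context {R : realType} {n : nat}.
Implicit Types x z : 'rV[R]_n.

(** The degenerate case [b = 0]: a straight segment at constant height is horizontal. *)
Lemma d_CC_le_segment x1 x (u : R) :
  (d_CC (x1, u) (x, u) <= (Num.sqrt (sqnorm (x - x1)))%:E)%E.
Proof.
pose X (t : R) := x1 + t *: (x - x1).
have := @d_CC_le_speed R n 0 (Num.sqrt (sqnorm (x - x1))) X (fun=> x - x1) (fun=> u).
rewrite /X scale0r addr0 scale1r (addrC x1) subrK; apply => //.
- move=> t j; rewrite (_ : (fun s => _) = fun s => x1 0 j + s * (x - x1) 0 j); last first.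
    by apply/funext => s; rewrite !mxE.
  by apply: is_derive_eq; rewrite /GRing.scale/=; ring.
- by move=> t; apply: is_derive_eq; rewrite mul0r.
- by move=> t; rewrite expr0n mul0r addr0 sqr_sqrtr// sqnorm_ge0.
Qed.

(** The increment of [u] is the integral of [b |cos (b t) x + sin (b t) z|^2] over [[0, 1]]. The
    squared speed is constant, equal to [b^2 (|x|^2 + |z|^2)]. *)
Lemma d_CC_le_arc x z (b u : R) :
  (d_CC (x, u) (cos b *: x + sin b *: z,
     u + ((b + sin b * cos b) * sqnorm x + 2 * sin b ^+ 2 * dotv x z
          + (b - sin b * cos b) * sqnorm z) / 2)%R <=
   (`|b| * Num.sqrt (sqnorm x + sqnorm z))%:E)%E.
Proof.
pose X (t : R) := cos (b * t) *: x + sin (b * t) *: z.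
pose xi (t : R) := b *: (cos (b * t) *: z - sin (b * t) *: x).
pose U (t : R) := u + ((b * t + sin (b * t) * cos (b * t)) * sqnorm x
  + 2 * sin (b * t) ^+ 2 * dotv x z + (b * t - sin (b * t) * cos (b * t)) * sqnorm z) / 2.
have dcos t : is_derive t (1 : R) (fun t => cos (b * t)) (- sin (b * t) * b).
  have : is_derive t (1 : R) (fun t => b * t) b.
    by apply: is_derive_eq; rewrite /GRing.scale/= mulr1.
  by move=> H; have := @is_derive1_comp R cos (fun t => b * t) t _ _ (is_derive_cos _) H.
have dsin t : is_derive t (1 : R) (fun t => sin (b * t)) (cos (b * t) * b).
  have : is_derive t (1 : R) (fun t => b * t) b.
    by apply: is_derive_eq; rewrite /GRing.scale/= mulr1.
  by move=> H; have := @is_derive1_comp R sin (fun t => b * t) t _ _ (is_derive_sin _) H.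
have := @d_CC_le_speed R n b (`|b| * Num.sqrt (sqnorm x + sqnorm z)) X xi U.
rewrite /X /U !mulr0 !mulr1 cos0 sin0 scale1r scale0r expr0n !(mulr0, mul0r, addr0, subr0).
apply.
- by rewrite mulr_ge0// sqrtr_ge0.
- move=> t j.
  rewrite (_ : (fun s => _) = fun s => cos (b * s) * x 0 j + sin (b * s) * z 0 j); last first.
    by apply/funext => s; rewrite !mxE.
  by apply: is_derive_eq; rewrite /xi !mxE /GRing.scale/=; ring.
- move=> t; apply: is_derive_eq; rewrite /GRing.scale/= /X /sqnorm !dotvE (dotvC z x).
  have := cos2Dsin2 (b * t).
  move: (cos _) (sin _) (dotv x x) (dotv x z) (dotv z z) => c s A B C cs.
  transitivity (2^-1 * (A * (b * (c ^+ 2 + s ^+ 2) + b * (c ^+ 2 - s ^+ 2)) +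
      4 * B * s * c * b + C * (b * (c ^+ 2 + s ^+ 2) - b * (c ^+ 2 - s ^+ 2)))).
    by rewrite cs; ring.
  by field.
- move=> t; rewrite exprMn real_normK ?num_real// sqr_sqrtr ?addr_ge0 ?sqnorm_ge0//.
  rewrite /xi /X /sqnorm !dotvE (dotvC z x).
  have := cos2Dsin2 (b * t).
  move: (cos _) (sin _) (dotv x x) (dotv x z) (dotv z z) => c s A B C cs.
  transitivity (b ^+ 2 * ((c ^+ 2 + s ^+ 2) * (A + C))); first by ring.
  by rewrite cs mul1r.
Qed.

End Geodesics.

(** * The equation for [b] *)

Section Equation.
Context {R : realType}.
Implicit Types t b c m : R.

(** The right-hand side of the equation for [c = 1], with [t = b / 2]; [curvature_minus] is the one
    for [c = -1]. *)
Definition curvature_plus t := t / cos t ^+ 2 + tan t.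

(* At [t = 0] the junk value [x / 0 = 0] gives the continuous extension. *)
Definition curvature_minus t := t / sin t ^+ 2 - cos t / sin t.

Local Notation cplus := curvature_plus.
Local Notation cminus := curvature_minus.

Lemma mu_nu_half b c : - pi < b < pi ->
  mu_fun b + c * nu_fun b =
  (1 + c) / 2 * cplus (b / 2) + (1 - c) / 2 * cminus (b / 2).
Proof.
move=> bpi; rewrite /mu_fun /nu_fun /cplus /cminus /cot /tan.
have [->|b0] := eqVneq b 0; first by rewrite !(mul0r, sin0, invr0, mulr0, subr0, addr0).
have k0 := lt0r_neq0 (cos_half_gt0 bpi); have s0 := sin_half_neq0 bpi b0.
have ks := cos2Dsin2 (b / 2).
rewrite (sin_half b) (cos_half b); move: (cos _) (sin _) k0 s0 ks => k s k0 s0 ks.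
(* Writing [1] as [k^2 + s^2] where it is needed leaves an identity of rational functions. *)
transitivity (b * (k ^+ 2 + s ^+ 2) / (2 * s * k) ^+ 2 - (k ^+ 2 - s ^+ 2) / (2 * s * k) +
  c * ((k ^+ 2 + s ^+ 2 - b * ((k ^+ 2 - s ^+ 2) / (2 * s * k))) / (2 * s * k))).
  by rewrite ks mulr1.
by field; rewrite k0 s0.
Qed.

Lemma cplusN t : cplus (- t) = - cplus t.
Proof. by rewrite /cplus cosN tanN mulNr opprD. Qed.

Lemma cminusN t : cminus (- t) = - cminus t.
Proof. by rewrite /cminus cosN sinN sqrrN invrN mulrN mulNr opprK opprB addrC. Qed.

Lemma cminus0 : cminus 0 = 0.
Proof. by rewrite /cminus sin0 invr0 mul0r mulr0 subrr. Qed.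

Let is_derive_sinM t : is_derive t (1 : R) (fun t => sin t - t * cos t) (t * sin t).
Proof. by apply: is_derive_eq; rewrite /GRing.scale/=; ring. Qed.

(** The difference vanishes at [0] and has derivative [t sin t]. Its sign is that of the derivative
    of [curvature_minus], and it also gives [t < tan t]. *)
Lemma mul_cos_lt_sin t : 0 < t <= pi / 2 -> t * cos t < sin t.
Proof.
move=> /andP[t0 tpi]; rewrite -subr_gt0.
have [||c] := @MVT R (fun t => sin t - t * cos t) (fun t => t * sin t) 0 t t0.
- by move=> x _; exact: is_derive_sinM.
- apply: derivable_within_continuous => x _; have := is_derive_sinM x => H; exact: ex_derive.
rewrite in_itv/= => /andP[c0 ct]; rewrite sin0 mul0r !subr0 => ->.
by rewrite !mulr_gt0// sin_gt0_pihalf// c0 (lt_le_trans ct).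
Qed.

Let is_derive_sincos t : is_derive t (1 : R) (fun t => t - sin t * cos t)
  (1 - cos t ^+ 2 + sin t ^+ 2).
Proof. by apply: is_derive_eq; rewrite /GRing.scale/=; ring. Qed.

Lemma sin_cos_lt t : 0 < t <= pi / 2 -> sin t * cos t < t.
Proof.
move=> /andP[t0 tpi]; rewrite -subr_gt0.
have [||c] := @MVT R (fun t => t - sin t * cos t)
  (fun t => 1 - cos t ^+ 2 + sin t ^+ 2) 0 t t0.
- by move=> x _; exact: is_derive_sincos.
- apply: derivable_within_continuous => x _; have := is_derive_sincos x => H; exact: ex_derive.
rewrite in_itv/= => /andP[c0 ct]; rewrite sin0 mul0r !subr0 => ->.
rewrite -sin2cos2 mulr_gt0// addr_gt0// exprn_gt0// sin_gt0_pihalf// c0;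
  exact: lt_le_trans tpi.
Qed.

Let sin_gt0 t : 0 < t <= pi / 2 -> 0 < sin t.
Proof.
by move=> /andP[t0 tpi]; apply: sin_gt0_pi; rewrite t0 (le_lt_trans tpi)//; have := pi_gt0 R; lra.
Qed.

Lemma cminus_gt0 t : 0 < t <= pi / 2 -> 0 < cminus t.
Proof.
move=> tpi; have s0 := sin_gt0 tpi.
rewrite (_ : cminus t = (t - sin t * cos t) / sin t ^+ 2); last first.
  by rewrite /cminus; field; exact: lt0r_neq0.
by rewrite divr_gt0 ?exprn_gt0// subr_gt0 sin_cos_lt.
Qed.

Let is_derive_cminus t : 0 < t <= pi / 2 ->
  is_derive t (1 : R) cminus (2 * (sin t - t * cos t) / sin t ^+ 3).
Proof.
move=> tpi; have s0 := lt0r_neq0 (sin_gt0 tpi).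
have Hs : is_derive t (1 : R) (fun t => (sin t)^-1) (- (sin t) ^- 2 *: cos t).
  exact: is_deriveV.
rewrite (_ : cminus = fun t => t * ((sin t)^-1 * (sin t)^-1) - cos t * (sin t)^-1).
  apply: is_derive_eq; rewrite /GRing.scale/=.
  have := cos2Dsin2 t; move: (cos t) (sin t) s0 => k s s0 ks.
  transitivity ((1 + (k ^+ 2 + s ^+ 2)) / s ^+ 2 - 2 * (t * k) / s ^+ 3).
    by field.
  by rewrite ks; field.
by apply/funext => x; rewrite /cminus expr2 invfM.
Qed.

Let cminus_continuous a d : 0 < a -> d <= pi / 2 -> {within `[a, d], continuous cminus}.
Proof.
move=> a0 dpi; apply: derivable_within_continuous => x; rewrite in_itv/= => xad.
have [|H _] := is_derive_cminus (t := x); last exact: H.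
by lra.
Qed.

Let cminus_lt_pos t1 t2 : 0 < t1 -> t1 < t2 -> t2 <= pi / 2 -> cminus t1 < cminus t2.
Proof.
move=> t10 t12 t2pi; rewrite -subr_gt0.
have [||c] := @MVT R cminus (fun t => 2 * (sin t - t * cos t) / sin t ^+ 3) t1 t2 t12.
- by move=> x; rewrite in_itv/= => xt; apply: is_derive_cminus; lra.
- exact: cminus_continuous.
rewrite in_itv/= => ct ->; have cpi : 0 < c <= pi / 2 by lra.
rewrite mulr_gt0 ?subr_gt0// divr_gt0 ?exprn_gt0 ?sin_gt0//.
by rewrite mulr_gt0// subr_gt0 mul_cos_lt_sin.
Qed.

(** The derivative is used for positive arguments, oddness transfers the result to negative ones,
    and across [0] the signs of the two values decide. *)
Lemma cminus_lt t1 t2 : - (pi / 2) < t1 -> t1 < t2 -> t2 < pi / 2 ->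
  cminus t1 < cminus t2.
Proof.
move=> t1pi t12 t2pi.
have pos t : 0 < t -> t < pi / 2 -> 0 < cminus t.
  by move=> t0 tpi; apply: cminus_gt0; lra.
have [t10|] := ltP 0 t1; first by apply: cminus_lt_pos => //; exact: ltW.
have [t20|t20 t10] := ltP t2 0.
  move=> _; rewrite -ltrN2 -!cminusN; apply: cminus_lt_pos; lra.
have c1 : cminus t1 <= 0.
  move: t10; rewrite le_eqVlt => /predU1P[->|t10]; first by rewrite cminus0.
  by rewrite -oppr_ge0 -cminusN ltW// pos; lra.
have c2 : 0 <= cminus t2.
  by move: t20; rewrite le_eqVlt => /predU1P[<-|t20]; rewrite ?cminus0// ltW// pos.
rewrite lt_neqAle (le_trans c1 c2) andbT; apply/eqP => E.
have [t1n|t1p] := ltP t1 0.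
  by have := pos (- t1); rewrite cminusN; lra.
by have := pos t2; lra.
Qed.

(** In the form [t + t tan^2 t + tan t] the outer terms increase and the middle one does not
    decrease, by cases on the signs of [t1] and [t2]. *)
Lemma cplus_lt t1 t2 : - (pi / 2) < t1 -> t1 < t2 -> t2 < pi / 2 ->
  cplus t1 < cplus t2.
Proof.
move=> t1pi t12 t2pi.
have tn (x y : R) : - (pi / 2) < x -> x < y -> y < pi / 2 -> tan x < tan y.
  by move=> xpi xy ypi; rewrite ltr_tan ?in_itv//=; lra.
have cE t : - (pi / 2) < t -> t < pi / 2 -> cplus t = t + t * tan t ^+ 2 + tan t.
  move=> t1' t2'; rewrite /cplus -exprVn exprVn cos2_tan2; first by ring.
  by apply/lt0r_neq0/cos_gt0_pihalf; rewrite t1'.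
have tp t : 0 <= t -> t < pi / 2 -> 0 <= tan t.
  rewrite le_eqVlt => /predU1P[<-|t0] tpi; first by rewrite tan0.
  by rewrite -(@tan0 R) ltW// tn//; have := pi_gt0 R; lra.
have tneg t : - (pi / 2) < t -> t <= 0 -> tan t <= 0.
  by move=> tpi t0; rewrite -oppr_ge0 -tanN tp; lra.
have tt := tn _ _ t1pi t12 t2pi.
rewrite !cE; [|lra..].
suff : t1 * tan t1 ^+ 2 <= t2 * tan t2 ^+ 2 by lra.
have sq1 := sqr_ge0 (tan t1); have sq2 := sqr_ge0 (tan t2).
have [t10|t10] := leP 0 t1.
  have p1 : 0 <= tan t1 by apply: tp; lra.
  have p2 : 0 <= tan t2 by apply: tp; lra.
  by apply: ler_pM => //; [exact: ltW|rewrite lerXn2r ?nnegrE// ltW].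
have [t20|t20] := leP 0 t2.
  by apply: (@le_trans _ _ 0); [rewrite nmulr_rle0|rewrite mulr_ge0].
apply: (@le_trans _ _ (t1 * tan t2 ^+ 2)); last by rewrite ler_wpM2r// ltW.
have n1 : 0 <= - tan t1 by rewrite oppr_ge0 tneg; lra.
have n2 : 0 <= - tan t2 by rewrite oppr_ge0 tneg; lra.
by rewrite ler_wnM2l ?(ltW t10)// -sqrrN -(sqrrN (tan t1)) lerXn2r ?nnegrE//; lra.
Qed.

Lemma curvature_lt c b1 b2 : -1 <= c <= 1 -> - pi < b1 -> b1 < b2 -> b2 < pi ->
  mu_fun b1 + c * nu_fun b1 < mu_fun b2 + c * nu_fun b2.
Proof.
move=> c1 b1pi b12 b2pi; rewrite !mu_nu_half; [|lra..].
have p12 : cplus (b1 / 2) < cplus (b2 / 2) by apply: cplus_lt; lra.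
have m12 : cminus (b1 / 2) < cminus (b2 / 2) by apply: cminus_lt; lra.
(* One weight may vanish; the sign of [c] tells which one is certainly positive. *)
have [c0|c0] := ltP c 0.
  apply: ler_ltD; first by rewrite ler_wpM2l ?(ltW p12)//; lra.
  by rewrite ltr_pM2l//; lra.
apply: ltr_leD; first by rewrite ltr_pM2l//; lra.
by rewrite ler_wpM2l ?(ltW m12)//; lra.
Qed.

Lemma tan_gt_id t : 0 < t < pi / 2 -> t < tan t.
Proof.
move=> /andP[t0 tpi]; rewrite ltr_pdivlMr ?mul_cos_lt_sin ?t0 ?ltW//.
by apply: cos_gt0_pihalf; lra.
Qed.

(** Replacing the numerator [t] by the larger [tan t] in [t / sin^2 t - cot t] gives exactly
    [tan t]. *)
Lemma cminus_le_tan t : 0 < t < pi / 2 -> cminus t <= tan t.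
Proof.
move=> tpi; have k0 : 0 < cos t by apply: cos_gt0_pihalf; lra.
have s0 : 0 < sin t by apply: sin_gt0; lra.
have k0' := lt0r_neq0 k0; have s0' := lt0r_neq0 s0.
apply: (@le_trans _ _ (tan t / sin t ^+ 2 - cos t / sin t)).
  by rewrite lerD2r ler_pM2r ?invr_gt0 ?exprn_gt0// ltW// tan_gt_id.
rewrite le_eqVlt; apply/orP; left; apply/eqP.
have := cos2Dsin2 t; rewrite /tan; move: (cos t) (sin t) k0' s0' => k s {}k0 {}s0 ks.
transitivity ((k ^+ 2 + s ^+ 2 - k ^+ 2) / (s * k)); last by field; rewrite k0 s0.
by rewrite ks; field; rewrite k0 s0.
Qed.

Let cplus_continuous a d : - (pi / 2) < a -> d < pi / 2 ->
  {within `[a, d], continuous cplus}.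
Proof.
move=> api dpi; apply: derivable_within_continuous => x; rewrite in_itv/= => xad.
have k0 : cos x != 0 by apply/lt0r_neq0/cos_gt0_pihalf; lra.
have Hk : is_derive x (1 : R) (fun t => (cos t)^-1) (- (cos x) ^- 2 *: (- sin x)).
  exact: is_deriveV.
have Ht := is_derive_tan k0.
rewrite (_ : cplus = fun t => t * ((cos t)^-1 * (cos t)^-1) + tan t).
  exact: ex_derive.
by apply/funext => t; rewrite /cplus expr2 invfM.
Qed.

(** Intermediate values in [t = b / 2], from a left endpoint [e] where both functions are at most
    [m]. For [c > -1] the unbounded [curvature_plus] exceeds [m]; for [c = -1] the right endpoint is
    [pi / 2], where [curvature_minus] equals [pi / 2 > m]. *)
Lemma curvature_solution_gt0 c m : -1 <= c <= 1 -> 0 < m ->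
  (c = -1 -> m < pi / 2) ->
  exists2 b, 0 < b < pi & m = mu_fun b + c * nu_fun b.
Proof.
move=> c1 m0 cm; have pi0 := pi_gt0 R.
suff [t tpi mt] : exists2 t, 0 < t < pi / 2 &
    m = (1 + c) / 2 * cplus t + (1 - c) / 2 * cminus t.
  exists (2 * t); first by lra.
  by rewrite mu_nu_half ?(mulrC 2) ?mulfK//; lra.
(* With [tan e = q], [curvature_plus e = e (1 + q^2) + q <= 3 q <= m]; this uses [e < q <= 1]. *)
pose q := Num.min 1 (m / 3).
have q0 : 0 < q by rewrite lt_min ltr01 divr_gt0.
have q1 : q <= 1 by rewrite ge_min lexx.
have qm : q <= m / 3 by rewrite ge_min lexx orbT.
pose e := atan q.
have e0 : 0 < e by rewrite -(@atan0 R) lt_atan.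
have epi : e < pi / 2 := atan_ltpi2 q.
have tane : tan e = q := atanK q.
have eq : e < q by rewrite -tane tan_gt_id// e0.
have ke : 0 < cos e by apply: cos_gt0_pihalf; lra.
have cpe : cplus e <= m.
  rewrite /cplus -exprVn exprVn cos2_tan2 ?lt0r_neq0// tane.
  have : e * (1 + q ^+ 2) <= q * 2 by rewrite ler_pM ?(ltW e0) ?(ltW eq)//; nra.
  lra.
have cme : cminus e <= m.
  by apply: (le_trans (cminus_le_tan _)); rewrite ?tane ?e0//; lra.
have [cN1|cN1] := eqVneq c (-1).
  have mpi := cm cN1.
  have cpi2 : cminus (pi / 2) = pi / 2.
    by rewrite /cminus sin_pihalf cos_pihalf mul0r subr0 expr1n divr1.
  have [||t] := @IVT R cminus e (pi / 2) m (ltW epi).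
  - exact: cminus_continuous.
  - by rewrite cpi2 ge_min le_max cme (ltW mpi) orbT.
  rewrite in_itv/= => /andP[et tpi] tm.
  exists t; last by rewrite cN1 tm; lra.
  rewrite (lt_le_trans e0 et) lt_neqAle tpi andbT; apply/eqP => tE.
  by move: tm; rewrite tE cpi2; lra.
have c1p : 0 < 1 + c by move: cN1; rewrite neq_lt => /orP[|]; lra.
(* With [tan d = M], the term [(1 + c) / 2 * tan d] alone is already [m]. *)
pose M := 2 * m / (1 + c).
have mM : m <= M by rewrite /M ler_pdivlMr//; nra.
pose d := atan M.
have ed : e <= d by apply: le_atan; lra.
have dpi : d < pi / 2 := atan_ltpi2 M.
have tand : tan d = M := atanK M.
have [||t] := @IVT R (fun t => (1 + c) / 2 * cplus t + (1 - c) / 2 * cminus t) e d m ed.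
- have cp : {within `[e, d], continuous cplus} by apply: cplus_continuous; lra.
  have cm' : {within `[e, d], continuous cminus} by apply: cminus_continuous; lra.
  move=> x; apply: cvgD; apply: cvgM; try exact: cvg_cst.
    exact: cp.
  exact: cm'.
- rewrite ge_min le_max; apply/andP; split; apply/orP; [left|right].
    have : (1 + c) / 2 * cplus e <= (1 + c) / 2 * m by rewrite ler_wpM2l//; lra.
    have : (1 - c) / 2 * cminus e <= (1 - c) / 2 * m by rewrite ler_wpM2l//; lra.
    lra.
  have cd : 0 < cminus d by apply: cminus_gt0; lra.
  have : 0 <= (1 - c) / 2 * cminus d by rewrite mulr_ge0 ?(ltW cd)//; lra.
  have : (1 + c) / 2 * M <= (1 + c) / 2 * cplus d.
    rewrite ler_wpM2l//; first by lra.
    by rewrite /cplus tand lerDr divr_ge0 ?sqr_ge0//; lra.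
  have -> : (1 + c) / 2 * M = m by rewrite /M; field; rewrite lt0r_neq0.
  lra.
by rewrite in_itv/= => etd tm; exists t; [lra|].
Qed.

Lemma curvature_solution c m : -1 <= c <= 1 -> (c = -1 -> `|m| < pi / 2) ->
  exists2 b, - pi < b < pi & m = mu_fun b + c * nu_fun b.
Proof.
move=> c1 cm; have pi0 := pi_gt0 R.
have [m0|m0|->] := ltgtP m 0; last first.
- by exists 0; [lra|rewrite /mu_fun /nu_fun eqxx mulr0 addr0].
- have [|b bpi mb] := curvature_solution_gt0 c1 m0.
    by move=> /cm; rewrite gtr0_norm.
  by exists b => //; lra.
have [||b bpi mb] := @curvature_solution_gt0 c (- m) c1; first by rewrite oppr_gt0.
  by move=> /cm; rewrite ltr0_norm.
exists (- b); first by lra.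
apply: oppr_inj; rewrite mb !mu_nu_half; [|lra..].
by rewrite mulNr cplusN cminusN; ring.
Qed.

End Equation.

(** * The distance *)

Section Distance.
Context {R : realType} {n : nat}.
Implicit Types (x : 'rV[R]_n) (b u : R).

Lemma b_over_sin_gt0 b : - pi < b < pi -> 0 < b_over_sin b.
Proof.
move=> bpi; rewrite /b_over_sin; have [//|b0] := eqVneq b 0.
move: b0; rewrite neq_lt => /orP[b0|b0].
  by rewrite -mulrNN -invrN -sinN divr_gt0 ?sin_gt0_pi//; lra.
by rewrite divr_gt0// sin_gt0_pi//; lra.
Qed.

Lemma b_cotE b : b_cot b = b_over_sin b * cos b.
Proof.
rewrite /b_cot /b_over_sin /cot; case: eqVneq => [->|_]; first by rewrite cos0 mulr1.
by rewrite mulrAC mulrA.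
Qed.

(** At [b = pi] or [b = - pi] the arc ends at the antipode whatever [z] is, so the length of [z]
    adjusts the height. The matching lower bound arises as [|b|] approaches [pi]. *)
Lemma d_CC_antipodal x (u1 u : R) : (1 <= n)%N ->
  2 * `|u - u1| >= pi * sqnorm x ->
  d_CC (- x, u1) (x, u) = (Num.sqrt (2 * pi * `|u - u1|))%:E.
Proof.
move=> hn hu; have pi0 := pi_gt0 R; have pin0 := lt0r_neq0 pi0.
apply/eqP; rewrite eq_le; apply/andP; split.
  case: n hn x hu => // n' _ x hu.
  (* At [|b| = pi] the height changes by [b (|x|^2 + |z|^2) / 2], which fixes the length of [z];
     [hu] makes the radicand nonnegative, and [hn] provides a direction. *)
  pose z : 'rV[R]_n'.+1 := Num.sqrt (2 * `|u - u1| / pi - sqnorm x) *: delta_mx 0 0.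
  have zE : sqnorm z = 2 * `|u - u1| / pi - sqnorm x.
    have dd : dotv (delta_mx 0 0 : 'rV[R]_n'.+1) (delta_mx 0 0) = 1.
      rewrite /dotv big_ord_recl big1 => [|i _]; last by rewrite !mxE mulr0.
      by rewrite !mxE mulr1 addr0.
    rewrite /z [LHS]/sqnorm dotvZl dotvZr dd mulr1 -expr2 sqr_sqrtr//.
    by rewrite subr_ge0 ler_pdivlMr// mulrC.
  pose b : R := if 0 <= u - u1 then pi else - pi.
  have cosb : cos b = -1 by rewrite /b; case: ifP; rewrite ?cosN cospi.
  have sinb : sin b = 0 by rewrite /b; case: ifP; rewrite ?sinN sinpi ?oppr0.
  have bu : b * `|u - u1| = pi * (u - u1).
    by rewrite /b; case: leP => h; [rewrite ger0_norm|rewrite ltr0_norm// mulrNN].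
  have := d_CC_le_arc (- x) z b u1.
  have xN : sqnorm (- x) = sqnorm x by rewrite /sqnorm !dotvE opprK.
  rewrite cosb sinb scale0r addr0 scaleN1r opprK xN zE.
  rewrite (_ : u1 + _ = u); last first.
    transitivity (u1 + b * `|u - u1| / pi); first by move: (pi : R) pin0 => P P0; field.
    by rewrite bu; move: (pi : R) pin0 => P P0; field.
  move/le_trans; apply; rewrite lee_fin addrC subrK.
  have -> : `|b| = pi by rewrite /b; case: ifP => _; rewrite ?normrN gtr0_norm.
  rewrite -{1}(@ger0_norm _ pi) ?(ltW pi0)// -sqrtr_sqr -sqrtrM ?sqr_ge0//.
  rewrite le_eqVlt; apply/orP; left; apply/eqP; congr Num.sqrt.
  by move: (pi : R) pin0 => P P0; field.
(* Between antipodal points the remaining part of the dual energy is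
   [2 |x|^2 (1 + cos b') b' / sin b'], which is nonnegative and dropped. *)
have lower b : 0 <= b < pi -> ((Num.sqrt (2 * b * `|u - u1|))%:E <= d_CC (- x, u1)%R (x, u))%E.
  move=> bpi; pose b' := if 0 <= u - u1 then b else - b.
  have b'pi : - pi < b' < pi by rewrite /b'; case: ifP; lra.
  apply: le_trans (dual_energy_le_d_CC _ _ b'pi); rewrite lee_fin; apply: ler_wsqrtr.
  rewrite /dual_energy /= b_cotE /sqnorm !dotvE opprK -!/(sqnorm x).
  have -> : 2 * b * `|u - u1| = 2 * b' * (u - u1).
    by rewrite /b'; case: leP => h; [rewrite ger0_norm|rewrite ltr0_norm//; ring].
  have bs := b_over_sin_gt0 b'pi; have := cos_geN1 b'; have := sqnorm_ge0 x.
  move=> X0 c1; have : 0 <= sqnorm x * b_over_sin b' * (1 + cos b').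
    by rewrite mulr_ge0 ?mulr_ge0 ?(ltW bs)//; lra.
  lra.
set A := `|u - u1| in lower hu *.
have := lower; case: (d_CC _ _) => [r||] lb; [|exact: leey|].
  rewrite lee_fin leNgt; apply/negP => rA.
  have r0 : 0 <= r.
    have := lb 0; rewrite mulr0 mul0r sqrtr0 !lee_fin; apply; lra.
  have A0 : 0 < A.
    rewrite lt_def normr_ge0 andbT; apply/eqP => A0.
    by move: rA; rewrite A0 mulr0 sqrtr0; lra.
  have r2 : r ^+ 2 < 2 * pi * A.
    by rewrite -(sqr_sqrtr (a := 2 * pi * A)) ?ltr_pXn2r ?nnegrE ?sqrtr_ge0// !mulr_ge0// ltW.
  (* If the distance [r] were too small, [2 b A] would exceed [r^2] for this [b < pi]. *)
  pose b := (r ^+ 2 / (2 * A) + pi) / 2.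
  have A2 : 0 < 2 * A by rewrite mulr_gt0.
  have rb : r ^+ 2 / (2 * A) < pi by rewrite ltr_pdivrMr//; lra.
  have rb0 : 0 <= r ^+ 2 / (2 * A) by rewrite divr_ge0 ?sqr_ge0// ltW.
  have bpi : 0 <= b < pi by rewrite /b; lra.
  have := lb b bpi; rewrite lee_fin -ler_sqr ?nnegrE ?sqrtr_ge0// sqr_sqrtr; last first.
    by rewrite !mulr_ge0//; lra.
  apply/negP; rewrite -ltNge -mulrA (mulrC b) mulrA -ltr_pdivrMl// mulrC /b; lra.
by have := lb 0; rewrite lexx pi0 => /(_ isT).
Qed.

(** The equation plays two roles: it turns the dual energy at [b] into the square of the claimed
    distance, and it says that the arc with parameter [b] from [x1] to [x] ends at height [u]. *)
Lemma d_CC_of_solution (x1 x : 'rV[R]_n) (u1 u b : R) :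
  0 < sqnorm x1 + sqnorm x -> - pi < b < pi ->
  2 * (u - u1) / (sqnorm x1 + sqnorm x) =
    mu_fun b + 2 * dotv x1 x / (sqnorm x1 + sqnorm x) * nu_fun b ->
  d_CC (x1, u1) (x, u) =
    (b_over_sin b * Num.sqrt (sqnorm x1 + sqnorm x - 2 * dotv x1 x * cos b))%:E /\
  d_CC (x1, u1) (x, u) =
    (Num.sqrt (2 * b * (u - u1) + (sqnorm x1 + sqnorm x) * b_cot b
       - 2 * dotv x1 x * b_over_sin b))%:E.
Proof.
move=> S0 bpi eqb; have bs := b_over_sin_gt0 bpi.
set S := sqnorm x1 + sqnorm x in S0 eqb *; set d := dotv x1 x in eqb *.
have S0' := lt0r_neq0 S0.
have ub : 2 * (u - u1) = S * mu_fun b + 2 * d * nu_fun b.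
  by rewrite -[LHS](divfK S0') eqb; field.
have EE : 2 * b * (u - u1) + S * b_cot b - 2 * d * b_over_sin b =
    b_over_sin b ^+ 2 * (S - 2 * d * cos b).
  rewrite mulrAC ub /b_cot /b_over_sin /mu_fun /nu_fun /cot.
  have [->|b0] := eqVneq b 0; first by rewrite cos0; ring.
  by field; rewrite sin_half !mulf_neq0// ?sin_half_neq0// lt0r_neq0// cos_half_gt0.
have E2 : Num.sqrt (2 * b * (u - u1) + S * b_cot b - 2 * d * b_over_sin b) =
    b_over_sin b * Num.sqrt (S - 2 * d * cos b).
  by rewrite EE sqrtrM ?sqr_ge0// sqrtr_sqr gtr0_norm.
rewrite E2; suff -> : d_CC (x1, u1) (x, u) =
  (b_over_sin b * Num.sqrt (S - 2 * d * cos b))%:E by [].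
apply/eqP; rewrite eq_le; apply/andP; split; last first.
  by rewrite -E2; exact: (dual_energy_le_d_CC (x1, u1) (x, u) bpi).
move: ub; rewrite /b_over_sin /mu_fun /nu_fun /cot.
have [->|b0] := eqVneq b 0.
  rewrite !mulr0 addr0 => ub; have -> : u = u1 by lra.
  rewrite cos0 mul1r mulr1 (_ : S - _ = sqnorm (x - x1)); first exact: d_CC_le_segment.
  by rewrite /S /d /sqnorm !dotvE (dotvC x x1); ring.
have s0 : sin b != 0.
  by rewrite sin_half !mulf_neq0// ?sin_half_neq0// lt0r_neq0// cos_half_gt0.
move=> ub; have cs := cos2Dsin2 b.
(* Solves [cos b x1 + sin b z = x]. *)
pose z := (sin b)^-1 *: (x - cos b *: x1).
have := d_CC_le_arc x1 z b u1.
have -> : cos b *: x1 + sin b *: z = x.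
  by rewrite /z scalerA mulfV// scale1r addrC subrK.
have dz : dotv x1 z = (d - cos b * sqnorm x1) / sin b.
  by rewrite /z !dotvE -/d -/(sqnorm x1) mulrC.
have zz : sqnorm z = (sqnorm x - 2 * cos b * d + cos b ^+ 2 * sqnorm x1) / sin b ^+ 2.
  by rewrite /z /sqnorm !dotvE (dotvC x x1) -/d; field.
rewrite (_ : u1 + _ = u); last first.
  rewrite dz zz; have -> : u = u1 + (2 * (u - u1)) / 2 by field.
  congr (_ + _ / 2); rewrite ub /S.
  move: (cos b) (sin b) s0 cs (sqnorm x) (sqnorm x1) => c s s0 cs Y X.
  (* The right-hand side of the equation plus a multiple of [c^2 + s^2 - 1], which makes the
     equality purely rational. *)
  transitivity ((X + Y) * (b / s ^+ 2 - c / s) + 2 * d * ((1 - b * (c / s)) / s)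
      + (c ^+ 2 + s ^+ 2 - 1) * ((b / s ^+ 2 - c / s) * X + 2 * d / s)); first by field.
  by rewrite cs subrr mul0r addr0.
move/le_trans; apply; rewrite lee_fin.
have -> : sqnorm x1 + sqnorm z = (S - 2 * d * cos b) / sin b ^+ 2.
  rewrite zz /S; transitivity
    (((cos b ^+ 2 + sin b ^+ 2) * sqnorm x1 + sqnorm x - 2 * d * cos b) / sin b ^+ 2).
    by field.
  by rewrite cs mul1r.
have -> : b / sin b = `|b / sin b|.
  by rewrite gtr0_norm//; move: bs; rewrite /b_over_sin (negbTE b0).
by rewrite normrM -[leRHS]mulrA ler_wpM2l// mulrC -exprVn sqrtrM ?sqr_ge0// sqrtr_sqr.
Qed.

End Distance.

Theorem theorem2p6 (R : realType) (n : nat) (hn : (1 <= n)%N)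
    (x1 x : 'rV[R]_n) (u1 u : R) :
  let exceptional := x1 = - x /\ 2 * `|u - u1| >= pi * sqnorm x in
  let eqn (b : R) :=
    2 * (u - u1) / (sqnorm x1 + sqnorm x) =
    mu_fun b + 2 * dotv x1 x / (sqnorm x1 + sqnorm x) * nu_fun b in
  (exceptional ->
     d_CC (x1, u1) (x, u) = (Num.sqrt (2 * pi * `|u - u1|))%:E) /\
  (~ exceptional ->
     (exists! b : R, - pi < b < pi /\ eqn b) /\
     (forall b : R, - pi < b < pi -> eqn b ->
        d_CC (x1, u1) (x, u) =
          (b_over_sin b *
             Num.sqrt (sqnorm x1 + sqnorm x - 2 * dotv x1 x * cos b))%:E /\
        d_CC (x1, u1) (x, u) =
          (Num.sqrt (2 * b * (u - u1) + (sqnorm x1 + sqnorm x) * b_cot b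
             - 2 * dotv x1 x * b_over_sin b))%:E)).
Proof.
move=> exceptional eqn; split=> [[-> hu]|nexc]; first exact: d_CC_antipodal.
have X10 := sqnorm_ge0 x1; have X0 := sqnorm_ge0 x.
(* If both points lie over the origin, the case is exceptional. *)
have S0 : 0 < sqnorm x1 + sqnorm x.
  rewrite lt_def addr_ge0// andbT; apply/negP => /eqP S0; apply: nexc.
  have x0 : x = 0 by apply: sqnorm_eq0; lra.
  have x10 : x1 = 0 by apply: sqnorm_eq0; lra.
  split; first by rewrite x0 x10 oppr0.
  by rewrite (_ : sqnorm x = 0) ?mulr0 ?mulr_ge0//; lra.
split; last by move=> b; exact: d_CC_of_solution.
set c := 2 * dotv x1 x / (sqnorm x1 + sqnorm x) in eqn *.
have sqD : sqnorm (x1 + x) = sqnorm x1 + sqnorm x + 2 * dotv x1 x.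
  by rewrite /sqnorm !dotvE (dotvC x x1); ring.
have sqB : sqnorm (x1 - x) = sqnorm x1 + sqnorm x - 2 * dotv x1 x.
  by rewrite /sqnorm !dotvE (dotvC x x1); ring.
have c1 : -1 <= c <= 1.
  have := sqnorm_ge0 (x1 + x); have := sqnorm_ge0 (x1 - x).
  by rewrite sqD sqB /c ler_pdivlMr// ler_pdivrMr//; lra.
have [|b bpi eqb] := @curvature_solution R c (2 * (u - u1) / (sqnorm x1 + sqnorm x)) c1.
  (* [c = -1] means [|x1 + x|^2 = 0]. The left-hand side is then [(u - u1) / |x|^2], and being
     non-exceptional bounds it by [pi / 2]. *)
  move=> cN1; have x1N : x1 = - x.
    apply/eqP; rewrite -addr_eq0; apply/eqP/sqnorm_eq0; rewrite sqD.
    have : 2 * dotv x1 x = - (sqnorm x1 + sqnorm x).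
      by rewrite -[LHS](divfK (lt0r_neq0 S0)) -/c cN1 mulN1r.
    lra.
  rewrite ltNge; apply/negP => mpi; apply: nexc; split=> //.
  have SE : sqnorm x1 + sqnorm x = 2 * sqnorm x.
    by rewrite x1N /sqnorm !dotvE; ring.
  have xp : 0 < sqnorm x by lra.
  move: mpi; rewrite SE (_ : 2 * (u - u1) / _ = (u - u1) / sqnorm x); last first.
    by field; exact: lt0r_neq0.
  by rewrite normrM normfV (gtr0_norm xp) ler_pdivlMr//; lra.
exists b; split=> // b' [b'pi eqb'].
have : mu_fun b + c * nu_fun b = mu_fun b' + c * nu_fun b' by rewrite -eqb -eqb'.
have [bb'|bb'|//] := ltgtP b b'.
  by have := curvature_lt (b1 := b) (b2 := b') c1; lra.
by have := curvature_lt (b1 := b') (b2 := b) c1; lra.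
Qed.
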